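(* Let $I=(-1,1)$ and let $A_{\mathtt N}$ be the self-adjoint operator in $L^2_{\mathbb{C}}(I)$ given by $-\frac4{\pi^2}\frac{d^2}{dx^2}$ with Neumann boundary conditions. Let $C\in L^2(I)$ be even. Then $$C*_{\mathtt p}P_{\mathrm{even}}=\varphi_1(A_{\mathtt N}),\qquad C*_{\mathtt a}P_{\mathrm{odd}}=\varphi_2(A_{\mathtt N}),$$ where $\varphi_1,\varphi_2$ are the bounded functions on $\sigma(A_{\mathtt N})=\{k^2:k\in\mathbb{N}\}$ defined by $$\varphi_1(k^2):=\begin{cases}0&\text{if }k\text{ is odd}\\ \langle e^{\mathtt p}_{k/2}|C\rangle&\text{if }k\text{ is even}\end{cases},\qquad \varphi_2(k^2):=\begin{cases}\langle e^{\mathtt a}_{(k-1)/2}|C\rangle&\text{if }k\text{ is odd}\\0&\text{if }k\text{ is even}\end{cases}\qquad(k\in\mathbb{N}).$$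
   Context: $\mathbb{N}=\{0,1,2,\dots\}$; $L^2(I)$ denotes real-valued, $L^2_{\mathbb{C}}(I)$ complex-valued square integrable functions; $\langle g|h\rangle=\int_{-1}^1g^*h$. $e^{\mathtt p}_k(x)=\frac1{\sqrt2}e^{i\pi kx}$ and $e^{\mathtt a}_k(x)=\frac1{\sqrt2}e^{i\pi(k+\frac12)x}$ for $k\in\mathbb{Z}$; each family is a Hilbert basis of $L^2_{\mathbb{C}}(I)$, and $C*_{\mathtt p}u=\sum_{k\in\mathbb{Z}}\langle e_k^{\mathtt p}|C\rangle\langle e_k^{\mathtt p}|u\rangle e_k^{\mathtt p}$, $C*_{\mathtt a}u=\sum_{k\in\mathbb{Z}}\langle e_k^{\mathtt a}|C\rangle\langle e_k^{\mathtt a}|u\rangle e_k^{\mathtt a}$. $P_{\mathrm{even}}h(x)=\frac12(h(x)+h(-x))$, $P_{\mathrm{odd}}h(x)=\frac12(h(x)-h(-x))$; $C*_{\mathtt p}P_{\mathrm{even}}$ is the operator $h\mapsto C*_{\mathtt p}(P_{\mathrm{even}}h)$, similarly $C*_{\mathtt a}P_{\mathrm{odd}}$. The eigenfunctions of $A_{\mathtt N}$ are $e_0=\frac1{\sqrt2}$, $e_k(x)=\cos(\frac{k\pi}2(x+1))$ ($k\geqslant1$) with simple eigenvalues $k^2$, forming a Hilbert basis, and for a bounded function $\varphi$ on $\sigma(A_{\mathtt N})$, $\varphi(A_{\mathtt N})u=\sum_{k\in\mathbb{N}}\varphi(k^2)\langle e_k|u\rangle e_k$. *)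

(* Defs.v *)
From HB Require Import structures.
From mathcomp Require Import all_boot all_order all_algebra finmap.
From mathcomp Require Import complex.
From mathcomp Require Import all_classical all_reals all_analysis.

Set Implicit Arguments.
Unset Strict Implicit.
Unset Printing Implicit Defensive.
Import Order.TTheory GRing.Theory Num.Theory.
Import numFieldNormedType.Exports.

Local Open Scope classical_set_scope.
Local Open Scope ring_scope.
Local Open Scope complex_scope.

(* Elements of L^2(I) and L^2_C(I) are represented by functions on R, of which
   only the values almost everywhere on I = ]-1, 1[ matter. *)

Definition II (R : realType) : set R := `]-1, 1[%classic.
Arguments II R : clear implicits.

Definition ae_eqI (R : realType) (T : Type) (f g : R -> T) : Prop :=
  {ae (@lebesgue_measure R), forall x, II R x -> f x = g x}.

Definition ae_even (R : realType) (T : Type) (f : R -> T) : Prop :=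
  ae_eqI (fun x => f (- x)) f.

Definition L2R (R : realType) (f : R -> R) : Prop :=
  measurable_fun (II R) f /\
  (@lebesgue_measure R).-integrable (II R) (fun x => (f x ^+ 2)%:E).

Definition L2C (R : realType) (f : R -> R[i]) : Prop :=
  L2R (fun x => complex.Re (f x)) /\ L2R (fun x => complex.Im (f x)).

Definition cplx (R : realType) (f : R -> R) : R -> R[i] := fun x => (f x)%:C.

Definition cintegral (R : realType) (D : set R) (f : R -> R[i]) : R[i] :=
  (\int[@lebesgue_measure R]_(x in D) complex.Re (f x)) +i*
  (\int[@lebesgue_measure R]_(x in D) complex.Im (f x)).

(* <g|h>, antilinear in the first argument *)
Definition ip (R : realType) (g h : R -> R[i]) : R[i] :=
  cintegral (II R) (fun x => (g x)^* * h x).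

Definition L2norm (R : realType) (f : R -> R[i]) : R :=
  Num.sqrt (complex.Re (ip f f)).

(* v = \sum_k f_k, the sum converging unconditionally in L^2_C(I), that is,
   along the finite subsets of the index type ordered by inclusion. *)
Definition has_L2_sum (R : realType) (K : choiceType) (f : K -> R -> R[i])
    (v : R -> R[i]) : Prop :=
  L2C v /\
  forall eps : R, 0 < eps -> exists J0 : {fset K}, forall J : {fset K},
    (J0 `<=` J)%fset ->
    L2norm (fun x => v x - \sum_(k <- J) f k x) < eps.

(* An operator in L^2_C(I) is given by its graph: [A u w] means that u is in
   the domain of A and A u = w. *)
Definition operator (R : realType) : Type := (R -> R[i]) -> (R -> R[i]) -> Prop.

(* Equality of everywhere defined operators *)
Definition eq_operator (R : realType) (S T : operator R) : Prop :=
  forall u, L2C u -> (exists v, S u v) /\ (forall v, S u v <-> T u v).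

(* Orthonormal family with dense linear span *)
Definition hilbert_basis (R : realType) (K : choiceType)
    (e : K -> R -> R[i]) : Prop :=
  [/\ forall k, L2C (e k),
      forall j k, ip (e j) (e k) = (j == k)%:R &
      forall u, L2C u -> forall eps : R, 0 < eps ->
        exists (J : {fset K}) (c : K -> R[i]),
          L2norm (fun x => u x - \sum_(k <- J) c k * e k x) < eps].

Definition diagonalized_by (R : realType) (A : operator R) (K : choiceType)
    (lam : K -> R) (e : K -> R -> R[i]) : Prop :=
  hilbert_basis e /\ forall k, A (e k) (fun x => (lam k)%:C * e k x).

(* phi(A) u = \sum_k phi(lam_k) <e_k|u> e_k, for an operator A diagonalized by
   the Hilbert basis e with eigenvalues lam *)
Definition functional_calculus (R : realType) (A : operator R)
    (K : choiceType) (lam : K -> R) (e : K -> R -> R[i])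
    (phi : R -> R[i]) : operator R :=
  fun u v => diagonalized_by A lam e /\
    has_L2_sum (fun k x => phi (lam k) * ip (e k) u * e k x) v.

Definition bounded_on (R : realType) (S : set R) (phi : R -> R[i]) : Prop :=
  exists M : R, forall t, S t -> `|phi t| <= M%:C.

(* f is absolutely continuous on [-1, 1] with derivative g *)
Definition primitive_of (R : realType) (g f : R -> R[i]) : Prop :=
  forall x : R, x \in `[-1, 1] -> f x = f (-1) + cintegral `[-1, x]%classic g.

(* A_N = - (4 / pi^2) d^2/dx^2 on the domain of those u in H^2(I) with
   u'(-1) = u'(1) = 0: u has a continuously differentiable representative u0
   whose derivative u1 is absolutely continuous with u1' = u2 in L^2_C(I). *)
Definition A_N (R : realType) : operator R := fun u w =>
  [/\ L2C u, L2C w &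
    exists u0 u1 u2 : R -> R[i],
      [/\ ae_eqI u u0, primitive_of u1 u0, primitive_of u2 u1 & L2C u2] /\
      [/\ u1 (-1) = 0, u1 1 = 0 &
          ae_eqI w (fun x => (- (4 / pi ^+ 2))%:C * u2 x)]].
Arguments A_N R u w : clear implicits.

Definition e_N (R : realType) (k : nat) : R -> R[i] := fun x =>
  if k is 0%N then ((Num.sqrt 2)^-1)%:C
  else (cos (k%:R * pi / 2 * (x + 1)))%:C.
Arguments e_N R k : clear implicits.

Definition lam_N (R : realType) (k : nat) : R := (k ^ 2)%:R.
Arguments lam_N R k : clear implicits.

Definition spectrum_N (R : realType) : set R := range (lam_N R).
Arguments spectrum_N R : clear implicits.

Definition cis (R : realType) (t : R) : R[i] := cos t +i* sin t.

Definition e_p (R : realType) (k : int) : R -> R[i] := fun x =>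
  ((Num.sqrt 2)^-1)%:C * cis (pi * k%:~R * x).
Arguments e_p R k : clear implicits.

Definition e_a (R : realType) (k : int) : R -> R[i] := fun x =>
  ((Num.sqrt 2)^-1)%:C * cis (pi * (k%:~R + 2^-1) * x).
Arguments e_a R k : clear implicits.

(* h |-> \sum_k <e_k|C> <e_k|h> e_k: the convolution C *_p for e = e_p and
   C *_a for e = e_a *)
Definition convolution (R : realType) (K : choiceType) (e : K -> R -> R[i])
    (C : R -> R[i]) : operator R :=
  fun u v => has_L2_sum (fun k x => ip (e k) C * ip (e k) u * e k x) v.

Definition P_even (R : realType) (h : R -> R[i]) : R -> R[i] :=
  fun x => (2^-1)%:C * (h x + h (- x)).

Definition P_odd (R : realType) (h : R -> R[i]) : R -> R[i] :=
  fun x => (2^-1)%:C * (h x - h (- x)).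

(* Main.v *)
Require Import Defs.
From HB Require Import structures.
From mathcomp Require Import all_boot all_order all_algebra finmap.
From mathcomp Require Import complex.
From mathcomp Require Import all_classical all_reals all_analysis.
From mathcomp Require Import measurable_realfun.
From mathcomp Require Import zify ring lra.

Import Order.TTheory GRing.Theory Num.Theory.
Import numFieldNormedType.Exports.

Local Open Scope classical_set_scope.
Local Open Scope ring_scope.
Local Open Scope complex_scope.

(** Write [e] for [e_p] or [e_a] and [C], [h] for the two factors. Bessel's
    inequality and [2 a b <= a^2 + b^2] make the coefficients [<e_k|C> <e_k|h>]
    absolutely summable, so [C * h] exists as a uniform limit. As [C] is even,
    [<e_k|C>] is invariant under the reflection [x |-> -x] of the index, which is
    [k |-> -k] for [e_p] and [k |-> -k-1] for [e_a]. Over a two-element orbit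
    {k, k'}, the sum [e_k + e_k'] (for [e_p]) or difference [e_k - e_k'] (for
    [e_a]) is a unimodular multiple of [sqrt 2 * cos (n pi (x + 1) / 2)], with
    [n = |2 k|], respectively [n = |2 k + 1|], that is, of an eigenfunction of
    [A_N].
    The cosines are complete because, with [t = cos (pi (x + 1) / 2)], their span
    is the algebra of polynomials in [t]; the polynomials
    [(1 - s^n)^(2^n)], [s] affine in [t], converge boundedly to indicators of
    half-lines, from which Dynkin's lemma gives all indicators of measurable
    sets, hence all of [L^2]. *)


(** * Real and imaginary parts of complex numbers *)

Section ComplexParts.
Context {R : realType}.
Implicit Types a b : R[i].

Lemma complex_ext a b :
  complex.Re a = complex.Re b -> complex.Im a = complex.Im b -> a = b.
Proof. by case: a b => [? ?] [? ?] /= -> ->. Qed.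

Lemma cReD a b : complex.Re (a + b) = complex.Re a + complex.Re b.
Proof. by case: a b => [? ?] [? ?]. Qed.

Lemma cImD a b : complex.Im (a + b) = complex.Im a + complex.Im b.
Proof. by case: a b => [? ?] [? ?]. Qed.

Lemma cReN a : complex.Re (- a) = - complex.Re a.
Proof. by case: a. Qed.

Lemma cImN a : complex.Im (- a) = - complex.Im a.
Proof. by case: a. Qed.

Lemma cReM a b : complex.Re (a * b) =
  complex.Re a * complex.Re b - complex.Im a * complex.Im b.
Proof. by case: a b => [? ?] [? ?]. Qed.

Lemma cImM a b : complex.Im (a * b) =
  complex.Re a * complex.Im b + complex.Im a * complex.Re b.
Proof. by case: a b => [? ?] [? ?]. Qed.

(* Inside a product [a^*] is parsed in [ring_scope], as [Num.conj a]; the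
   delimiter [%C] selects [conjc]. *)
Lemma cReJ a : complex.Re a^*%C = complex.Re a.
Proof. by case: a. Qed.

Lemma cImJ a : complex.Im a^*%C = - complex.Im a.
Proof. by case: a. Qed.

Lemma conjcD a b : (a + b)^*%C = a^*%C + b^*%C.
Proof. exact: rmorphD. Qed.

Lemma conjcB a b : (a - b)^*%C = a^*%C - b^*%C.
Proof. exact: rmorphB. Qed.

Lemma conjcM a b : (a * b)^*%C = a^*%C * b^*%C.
Proof. exact: rmorphM. Qed.

Definition ReImE := (cReD, cImD, cReN, cImN, cReM, cImM, cReJ, cImJ).

Lemma Re_sum (K : Type) (J : seq K) (f : K -> R[i]) :
  complex.Re (\sum_(k <- J) f k) = \sum_(k <- J) complex.Re (f k).
Proof.
by elim: J => [|k J IH]; rewrite ?big_nil// !big_cons cReD IH.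
Qed.

Lemma Im_sum (K : Type) (J : seq K) (f : K -> R[i]) :
  complex.Im (\sum_(k <- J) f k) = \sum_(k <- J) complex.Im (f k).
Proof.
by elim: J => [|k J IH]; rewrite ?big_nil// !big_cons cImD IH.
Qed.

(** The squared modulus is kept in [R], so that it can be integrated and compared without passing
    through the order on [R[i]]. *)
Definition sqnorm a : R := complex.Re a ^+ 2 + complex.Im a ^+ 2.

Lemma sqnorm_ge0 a : 0 <= sqnorm a.
Proof. by rewrite addr_ge0 ?sqr_ge0. Qed.

Lemma mulJc_sqnorm a : a^*%C * a = (sqnorm a)%:C.
Proof.
by apply: complex_ext; rewrite !ReImE/= /sqnorm; ring.
Qed.

Lemma sqnormM a b : sqnorm (a * b) = sqnorm a * sqnorm b.
Proof. by rewrite /sqnorm !ReImE; ring. Qed.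

Lemma sqnorm_normc a : sqnorm a = Normc.normc a ^+ 2.
Proof. by case: a => x y; rewrite /sqnorm /= sqr_sqrtr// addr_ge0 ?sqr_ge0. Qed.

End ComplexParts.

(** * Real-valued square integrable functions on [I] *)

Section RealL2.
Context {R : realType}.
Notation mu := (@lebesgue_measure R).
Notation I := (II R).
Implicit Types f g : R -> R.

Lemma measurable_II : measurable (I : set (measurableTypeR R)).
Proof. exact: measurable_itv. Qed.
Hint Resolve measurable_II : core.

Lemma measure_II : mu I = 2%:E.
Proof.
rewrite /II lebesgue_measure_itv/= lte_fin ifT; last lra.
by rewrite -EFinD opprK.
Qed.

(** Expanding the square of [|f| - |g|] gives [|f g| <= f^2 + g^2], an integrable majorant. *)
Lemma integrableM_L2R f g : L2R f -> L2R g ->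
  mu.-integrable I (EFin \o (fun x => f x * g x)).
Proof.
move=> [mf f2] [mg g2].
apply: (@le_integrable _ _ _ mu I measurable_II _
  (fun x => (f x ^+ 2)%:E + (g x ^+ 2)%:E)%E).
- by apply/measurable_EFinP/measurable_funM.
- move=> x _ /=; rewrite lee_fin [leRHS]ger0_norm ?addr_ge0 ?sqr_ge0//.
  rewrite normrM -(real_normK (num_real (f x))) -(real_normK (num_real (g x))).
  have := sqr_ge0 (`|f x| - `|g x|); have := normr_ge0 (f x).
  have := normr_ge0 (g x); nra.
- exact: integrableD.
Qed.

Lemma L2RD f g : L2R f -> L2R g -> L2R (fun x => f x + g x).
Proof.
move=> Hf Hg; have fg := integrableM_L2R _ _ Hf Hg.
case: Hf Hg => [mf f2] [mg g2]; split; first exact: measurable_funD.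
have h2 := integrableD measurable_II (integrableD measurable_II f2 g2)
             (integrableZl measurable_II 2 fg).
apply: eq_integrable h2 => // x _ /=.
by rewrite -EFinM -!EFinD; congr (_%:E); ring.
Qed.

Lemma L2RZ a f : L2R f -> L2R (fun x => a * f x).
Proof.
move=> [mf f2]; split; first exact: measurable_funM.
have h2 := integrableZl measurable_II (a ^+ 2) f2.
by apply: eq_integrable h2 => // x _ /=; rewrite -EFinM exprMn.
Qed.

Lemma L2RN f : L2R f -> L2R (fun x => - f x).
Proof.
by move=> /(L2RZ (-1)); under eq_fun do rewrite mulN1r.
Qed.

Lemma L2RB f g : L2R f -> L2R g -> L2R (fun x => f x - g x).
Proof. by move=> Hf /L2RN; exact: L2RD. Qed.

Lemma bounded_L2R f (M : R) : measurable_fun I f ->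
  (forall x, I x -> `|f x| <= M) -> L2R f.
Proof.
move=> mf fM; split => //.
apply: (@le_integrable _ _ _ mu I measurable_II _ (cst (M ^+ 2)%:E)).
- by apply/measurable_EFinP/measurable_funX.
- move=> x Ix; rewrite lee_fin [leRHS]ger0_norm ?sqr_ge0// normrX.
  by rewrite lerXn2r ?nnegrE//; [exact: le_trans (fM x Ix)|exact: fM].
- apply/integrableP; split => //; under eq_integral do rewrite /= ger0_norm ?sqr_ge0//.
  by rewrite integral_cst//= measure_II -EFinM ltry.
Qed.

Lemma continuous_L2R f : continuous f -> L2R f.
Proof.
move=> cf; have cI : {within `[-1, 1], continuous f}.
  exact: continuous_subspaceT.
have [M [_ HM]] := compact_bounded (continuous_compact cI (@segment_compact _ _ _)).
(* Boundedness provides a bound by every real above [M], hence [M + 1]. *)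
apply: (@bounded_L2R f (M + 1)).
  by apply: measurable_funTS; exact: continuous_measurable_fun.
move=> x Ix; apply: (HM (M + 1)); first by rewrite ltrDl.
by exists x => //; apply: subset_itv_oo_cc; exact: Ix.
Qed.

Definition rip f g : R := \int[mu]_(x in I) (f x * g x).

Lemma ripC f g : rip f g = rip g f.
Proof. by apply: eq_Rintegral => x _; rewrite mulrC. Qed.

Lemma ripDl f g h : L2R f -> L2R g -> L2R h ->
  rip (fun x => f x + g x) h = rip f h + rip g h.
Proof.
move=> Hf Hg Hh; rewrite -RintegralD//; try exact: integrableM_L2R.
by apply: eq_Rintegral => x _; rewrite mulrDl.
Qed.

Lemma ripZl a f h : L2R f -> L2R h -> rip (fun x => a * f x) h = a * rip f h.
Proof.
move=> Hf Hh; rewrite -RintegralZl//; try exact: integrableM_L2R.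
by apply: eq_Rintegral => x _; rewrite mulrA.
Qed.

Lemma ripBl f g h : L2R f -> L2R g -> L2R h ->
  rip (fun x => f x - g x) h = rip f h - rip g h.
Proof.
move=> Hf Hg Hh; rewrite -RintegralB//; try exact: integrableM_L2R.
by apply: eq_Rintegral => x _; rewrite mulrBl.
Qed.

Lemma ripDr f g h : L2R f -> L2R g -> L2R h ->
  rip h (fun x => f x + g x) = rip h f + rip h g.
Proof. by move=> *; rewrite ripC ripDl// !(ripC _ h). Qed.

Lemma ripZr a f h : L2R f -> L2R h -> rip h (fun x => a * f x) = a * rip h f.
Proof. by move=> *; rewrite ripC ripZl// (ripC _ h). Qed.

Lemma ripBr f g h : L2R f -> L2R g -> L2R h ->
  rip h (fun x => f x - g x) = rip h f - rip h g.
Proof. by move=> *; rewrite ripC ripBl// !(ripC _ h). Qed.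

End RealL2.
#[global] Hint Resolve measurable_II : core.

(** * The complex inner product *)

Section ComplexL2.
Context {R : realType}.
Notation mu := (@lebesgue_measure R).
Notation I := (II R).
Implicit Types f g u v : R -> R[i].

Lemma L2CD f g : L2C f -> L2C g -> L2C (fun x => f x + g x).
Proof.
move=> [f1 f2] [g1 g2]; split.
- by under eq_fun do rewrite cReD; exact: L2RD.
- by under eq_fun do rewrite cImD; exact: L2RD.
Qed.

Lemma L2CZ a f : L2C f -> L2C (fun x => a * f x).
Proof.
move=> [f1 f2]; split.
- by under eq_fun do rewrite cReM; apply: L2RB; exact: L2RZ.
- by under eq_fun do rewrite cImM; apply: L2RD; exact: L2RZ.
Qed.

Lemma L2CN f : L2C f -> L2C (fun x => - f x).
Proof.
by move=> /(L2CZ (-1)); under eq_fun do rewrite mulN1r.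
Qed.

Lemma L2CB f g : L2C f -> L2C g -> L2C (fun x => f x - g x).
Proof. by move=> Hf /L2CN; exact: L2CD. Qed.

Lemma L2C0 : L2C (fun _ : R => 0 : R[i]).
Proof. by split => /=; apply: continuous_L2R => x; exact: cvg_cst. Qed.

Lemma L2C_sum (K : Type) (J : seq K) (f : K -> R -> R[i]) :
  (forall k, L2C (f k)) -> L2C (fun x => \sum_(k <- J) f k x).
Proof.
move=> Hf; elim: J => [|k J IH].
  by under eq_fun do rewrite big_nil; exact: L2C0.
by under eq_fun do rewrite big_cons; exact: L2CD.
Qed.

Lemma cplx_L2C (h : R -> R) : L2R h -> L2C (cplx h).
Proof. by move=> Hh; split => //=; case: L2C0. Qed.

Let re f := fun x => complex.Re (f x).
Let im f := fun x => complex.Im (f x).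

Lemma ipE f g : L2C f -> L2C g -> ip f g =
  (rip (re f) (re g) + rip (im f) (im g)) +i*
  (rip (re f) (im g) - rip (im f) (re g)).
Proof.
move=> [f1 f2] [g1 g2]; rewrite /ip /cintegral /rip.
rewrite -RintegralD// -?RintegralB//; try exact: integrableM_L2R.
by congr (_ +i* _); apply: eq_Rintegral => x _; rewrite !ReImE; rewrite /re/im; ring.
Qed.

Lemma ipJ f g : L2C f -> L2C g -> ip g f = (ip f g)^*%C.
Proof.
move=> Hf Hg; rewrite !ipE//=; rewrite (ripC (re g)) (ripC (im g)).
by rewrite (ripC (re g)) (ripC (im g)); congr (_ +i* _); ring.
Qed.

Lemma ipDr f u v : L2C f -> L2C u -> L2C v ->
  ip f (fun x => u x + v x) = ip f u + ip f v.
Proof.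
move=> Hf Hu Hv; have Huv := L2CD _ _ Hu Hv; rewrite !ipE//.
case: Hf Hu Hv => f1 f2 [u1 u2] [v1 v2].
have -> : re (fun x => u x + v x) = (fun x => re u x + re v x).
  by apply/funext => x; rewrite /re cReD.
have -> : im (fun x => u x + v x) = (fun x => im u x + im v x).
  by apply/funext => x; rewrite /im cImD.
rewrite !ripDr//.
by apply: complex_ext => /=; ring.
Qed.

Lemma ipZr a f u : L2C f -> L2C u -> ip f (fun x => a * u x) = a * ip f u.
Proof.
move=> Hf Hu; have Huv := L2CZ a _ Hu; rewrite !ipE//.
case: Hf Hu => f1 f2 [u1 u2].
have -> : re (fun x => a * u x) =
    (fun x => complex.Re a * re u x - complex.Im a * im u x).
  by apply/funext => x; rewrite /re cReM.
have -> : im (fun x => a * u x) =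
    (fun x => complex.Re a * im u x + complex.Im a * re u x).
  by apply/funext => x; rewrite /im cImM.
rewrite !(ripBr, ripDr) ?ripZr//; try exact: L2RZ.
by apply: complex_ext; rewrite !ReImE/=; ring.
Qed.

Lemma ipDl f u v : L2C f -> L2C u -> L2C v ->
  ip (fun x => u x + v x) f = ip u f + ip v f.
Proof.
move=> Hf Hu Hv; rewrite ipJ// ?ipDr//; last exact: L2CD.
by rewrite conjcD (ipJ f u)// (ipJ f v).
Qed.

Lemma ipZl a f u : L2C f -> L2C u -> ip (fun x => a * u x) f = a^*%C * ip u f.
Proof.
move=> Hf Hu; rewrite ipJ// ?ipZr//; last exact: L2CZ.
by rewrite conjcM (ipJ f u).
Qed.

Lemma ipBr f u v : L2C f -> L2C u -> L2C v ->
  ip f (fun x => u x - v x) = ip f u - ip f v.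
Proof.
move=> Hf Hu Hv.
have -> : (fun x => u x - v x) = (fun x => u x + (-1) * v x).
  by apply/funext => x; rewrite mulN1r.
by rewrite ipDr ?ipZr ?mulN1r//; exact: L2CZ.
Qed.

Lemma ipBl f u v : L2C f -> L2C u -> L2C v ->
  ip (fun x => u x - v x) f = ip u f - ip v f.
Proof.
move=> Hf Hu Hv; rewrite ipJ// ?ipBr//; last exact: L2CB.
by rewrite conjcB (ipJ f u)// (ipJ f v).
Qed.

Lemma ip0r f : ip f (fun=> 0) = 0.
Proof.
rewrite /ip /cintegral; under eq_Rintegral do rewrite mulr0.
under [in X in _ +i* X]eq_Rintegral do rewrite mulr0.
by rewrite !Rintegral_cst// !mul0r.
Qed.

Lemma ip_sumr (K : Type) (J : seq K) f (g : K -> R -> R[i]) :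
  L2C f -> (forall k, L2C (g k)) ->
  ip f (fun x => \sum_(k <- J) g k x) = \sum_(k <- J) ip f (g k).
Proof.
move=> Hf Hg; elim: J => [|k J IH].
  by rewrite big_nil; under eq_fun do rewrite big_nil; exact: ip0r.
rewrite big_cons -IH; under eq_fun do rewrite big_cons.
by rewrite ipDr//; exact: L2C_sum.
Qed.

Lemma integrable_ip f g : L2C f -> L2C g ->
  mu.-integrable I (EFin \o (fun x => complex.Re ((f x)^*%C * g x))) /\
  mu.-integrable I (EFin \o (fun x => complex.Im ((f x)^*%C * g x))).
Proof.
move=> [f1 f2] [g1 g2]; split.
- have := integrableD measurable_II (integrableM_L2R _ _ f1 g1)
    (integrableM_L2R _ _ f2 g2).
  by apply: eq_integrable => // x _ /=; rewrite !ReImE -EFinD; congr EFin; ring.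
- have := integrableB measurable_II (integrableM_L2R _ _ f1 g2)
    (integrableM_L2R _ _ f2 g1).
  by apply: eq_integrable => // x _ /=; rewrite !ReImE -EFinB; congr EFin; ring.
Qed.

Lemma ae_ipr f u v : L2C f -> L2C u -> L2C v ->
  ae_eqI u v -> ip f u = ip f v.
Proof.
move=> Hf Hu Hv uv; have [u1 u2] := integrable_ip _ _ Hf Hu.
have [v1 v2] := integrable_ip _ _ Hf Hv.
rewrite /ip /cintegral /Rintegral; congr (fine _ +i* fine _);
  apply: ae_eq_integral => //; try exact: measurable_int.
- exact: measurable_int u1.
- exact: measurable_int v1.
- by move: uv; apply: (@filterS _ _ (ae_filter_ringOfSetsType mu)) => x xuv Ix;
  rewrite xuv.
- exact: measurable_int u2.
- exact: measurable_int v2.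
- by move: uv; apply: (@filterS _ _ (ae_filter_ringOfSetsType mu)) => x xuv Ix;
  rewrite xuv.
Qed.

End ComplexL2.


(** * The [L^2] norm, unconditional sums and Bessel's inequality *)

Section L2Norm.
Context {R : realType}.
Notation mu := (@lebesgue_measure R).
Notation I := (II R).
Implicit Types f g u v : R -> R[i].

Definition L2sq f : R := complex.Re (ip f f).

Lemma L2sqE f : L2sq f = \int[mu]_(x in I) sqnorm (f x).
Proof.
rewrite /L2sq /ip /cintegral /=; apply: eq_Rintegral => x _.
by rewrite !ReImE /sqnorm; ring.
Qed.

Lemma L2sq_ge0 f : 0 <= L2sq f.
Proof. by rewrite L2sqE; apply: Rintegral_ge0 => x _; exact: sqnorm_ge0. Qed.

Lemma L2norm_ltE f (eps : R) : 0 < eps -> (L2norm f < eps) = (L2sq f < eps ^+ 2).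
Proof.
move=> e0; rewrite /L2norm -(@ltr_pXn2r _ 2%N)// ?nnegrE ?sqrtr_ge0 ?ltW//.
by rewrite sqr_sqrtr// -/(L2sq f) L2sq_ge0.
Qed.

Lemma integrable_sqnorm f : L2C f ->
  mu.-integrable I (EFin \o (fun x => sqnorm (f x))).
Proof.
move=> [f1 f2]; have [_ i1] := f1; have [_ i2] := f2.
have := integrableD measurable_II i1 i2.
by apply: eq_integrable.
Qed.

Lemma L2sq_distC f g : L2sq (fun x => f x - g x) = L2sq (fun x => g x - f x).
Proof.
by rewrite !L2sqE; apply: eq_Rintegral => x _; rewrite /sqnorm !ReImE; ring.
Qed.

Lemma L2norm_distC f g : L2norm (fun x => f x - g x) = L2norm (fun x => g x - f x).
Proof. by rewrite /L2norm -!/(L2sq _) L2sq_distC. Qed.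

(** By the parallelogram identity the right-hand side exceeds the left by the squared norm of
    [f - g]. This takes the place of the triangle inequality. *)
Lemma L2sqD_le f g : L2C f -> L2C g ->
  L2sq (fun x => f x + g x) <= 2 * L2sq f + 2 * L2sq g.
Proof.
move=> Hf Hg.
suff : L2sq (fun x => f x + g x) + L2sq (fun x => f x - g x) =
    2 * L2sq f + 2 * L2sq g.
  by move=> <-; rewrite lerDl L2sq_ge0.
rewrite /L2sq ipDr ?ipBr//; try exact: L2CB; try exact: L2CD.
by rewrite !ipBl// !ipDl// !ReImE; ring.
Qed.

Lemma L2norm_trans f g h (eps : R) : L2C f -> L2C g -> L2C h ->
  L2norm (fun x => f x - g x) < eps / 2 -> L2norm (fun x => g x - h x) < eps / 2 ->
  L2norm (fun x => f x - h x) < eps.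
Proof.
move=> Hf Hg Hh fg gh.
have e0 : 0 < eps / 2 by apply: le_lt_trans fg; exact: sqrtr_ge0.
move: fg gh; rewrite !L2norm_ltE//; last lra.
have -> : (fun x => f x - h x) = (fun x => (f x - g x) + (g x - h x)).
  by apply/funext => x; rewrite addrA subrK.
have := L2sqD_le _ _ (L2CB _ _ Hf Hg) (L2CB _ _ Hg Hh).
rewrite !expr2; lra.
Qed.

Lemma integrable_cst_II (M : R) : mu.-integrable I (EFin \o (fun=> M)).
Proof.
apply/integrableP; split; first exact: measurable_cst.
rewrite (_ : (fun x => _) = cst `|M|%:E)//.
rewrite integral_cst//=; last exact: measurable_itv.
have := @measure_II R; move=> /= ->; by rewrite -EFinM ltry.
Qed.

Lemma Rintegral_II_cst (M : R) : \int[mu]_(x in I) M = M * 2.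
Proof. by rewrite Rintegral_cst// (congr1 fine (@measure_II R)). Qed.

Lemma L2sq_le f (M : R) : L2C f -> (forall x, I x -> sqnorm (f x) <= M) ->
  L2sq f <= M * 2.
Proof.
move=> Hf fM; rewrite -Rintegral_II_cst L2sqE; apply: le_Rintegral => //.
  exact: integrable_sqnorm.
exact: integrable_cst_II.
Qed.

(** Sums in [L^2] are determined only up to null sets. Here [v] and [v0] are both close to the
    partial sum of [f] over [J0 U J1], hence to each other, so the partial sums of [g], which
    approach [v0], approach [v] as well. *)
Lemma has_L2_sum_transfer (K K' : choiceType) (f : K -> R -> R[i])
    (g : K' -> R -> R[i]) v v0 :
  (forall k, L2C (f k)) -> (forall k, L2C (g k)) ->
  has_L2_sum f v0 -> has_L2_sum g v0 -> has_L2_sum f v -> has_L2_sum g v.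
Proof.
move=> Hf Hg [Hv0 fv0] [_ gv0] [Hv fv]; split => // eps e0.
have e2 : 0 < eps / 2 by lra.
have e4 : 0 < eps / 2 / 2 by lra.
have [J0 HJ0] := fv0 _ e4; have [J1 HJ1] := fv _ e4.
have [J2 HJ2] := gv0 _ e2; exists J2 => J /HJ2 HJ.
apply: L2norm_trans HJ => //; first exact: L2C_sum.
apply: (L2norm_trans _ (fun x => \sum_(k <- (J0 `|` J1)%fset) f k x)) => //.
- exact: L2C_sum.
- by apply: HJ1; exact: fsubsetUr.
- by rewrite L2norm_distC; apply: HJ0; exact: fsubsetUl.
Qed.

(** An unconditional sum may be regrouped along the finite fibers [s n] of [p]. If [J] contains
    [p(J0)], then the union [L] of the fibers over [J] contains [J0], and the sum of [g] over [J] is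
    the sum of [f] over [L]. *)
Lemma has_L2_sum_fibers (K K' : choiceType) (p : K -> K') (s : K' -> {fset K})
    (f : K -> R -> R[i]) (g : K' -> R -> R[i]) v :
  (forall k n, (k \in s n) = (p k == n)) ->
  (forall n x, g n x = \sum_(k <- s n) f k x) ->
  has_L2_sum f v -> has_L2_sum g v.
Proof.
move=> sP gE [Hv fv]; split => // eps e0; have [J0 HJ0] := fv _ e0.
exists [fset p k | k in J0]%fset => J J0J.
pose L := (\bigcup_(n <- J) s n)%fset.
have J0L : (J0 `<=` L)%fset.
  apply/fsubsetP => k kJ0; apply/bigfcupP; exists (p k); last by rewrite sP.
  by rewrite andbT; apply: (fsubsetP J0J); exact: in_imfset.
rewrite (_ : (fun x => _) = (fun x => v x - \sum_(k <- L) f k x)); first exact: HJ0.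
apply/funext => x; congr (_ - _).
(* Each [k] in [L] lies over exactly one [n] in [J]; inserting this trivial inner sum prepares the
   exchange of summations. *)
have -> : \sum_(k <- L) f k x = \sum_(k <- L) \sum_(n <- J | p k == n) f k x.
  apply: eq_big_seq => k /bigfcupP[n /andP[nJ _]]; rewrite sP => /eqP pkn.
  rewrite -big_filter (_ : [seq _ <- _ | _] = [:: n]) ?big_seq1//.
  rewrite (eq_filter (a2 := pred1 n)) ?filter_pred1_uniq ?fset_uniq//.
  by move=> m; rewrite pkn; exact: eq_sym.
rewrite (exchange_big_dep xpredT)//=; apply: eq_big_seq => n nJ.
rewrite gE -[RHS]big_filter; apply: perm_big.
apply: uniq_perm; rewrite ?filter_uniq ?fset_uniq// => k.
rewrite mem_filter -sP; case: (boolP (k \in s n)) => //= kn.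
by apply/esym/bigfcupP; exists n; rewrite ?nJ.
Qed.

(** With [s] the projection of [u] on the span of the [e_k], [k] in [J], the inequality is the
    nonnegativity of the squared norm of [u - s], which equals that of [u] minus [B]. *)
Lemma bessel (K : choiceType) (e : K -> R -> R[i]) u (J : {fset K}) :
  (forall k, L2C (e k)) -> (forall j k, ip (e j) (e k) = (j == k)%:R) ->
  L2C u -> \sum_(k <- J) sqnorm (ip (e k) u) <= L2sq u.
Proof.
move=> He ee Hu; pose c k := ip (e k) u.
pose s := fun x => \sum_(k <- J) c k * e k x.
have Hce k : L2C (fun x => c k * e k x) by exact: L2CZ.
have Hs : L2C s by exact: L2C_sum.
have es k : k \in J -> ip (e k) s = c k.
  move=> kJ; rewrite ip_sumr// (bigD1_seq k) ?fset_uniq//=.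
  rewrite ipZr// ee eqxx mulr1 big1 ?addr0// => j jk.
  by rewrite ipZr// ee eq_sym (negbTE jk) mulr0.
pose B : R := \sum_(k <- J) sqnorm (c k).
(* One computation serves for both [<u|s>] and [<s|s>], since [u] and [s] have the same coefficients
   on [J]. *)
have BE f : (forall k, k \in J -> ip f (e k) = (c k)^*%C) -> L2C f -> ip f s = B%:C.
  move=> fe Hf; rewrite ip_sumr//.
  have -> : B%:C = \sum_(k <- J) (sqnorm (c k))%:C by rewrite /B rmorph_sum.
  apply: eq_big_seq => k kJ; by rewrite ipZr// fe// mulrC mulJc_sqnorm.
have us : ip u s = B%:C by apply: BE => // k _; rewrite (ipJ (e k) u).
have ss : ip s s = B%:C by apply: BE => // k kJ; rewrite (ipJ (e k) s)// es.
have su : ip s u = B%:C by rewrite (ipJ u s)// us conjc_real.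
rewrite -/B -subr_ge0.
have := L2sq_ge0 (fun x => u x - s x); rewrite /L2sq ipBr ?ipBl//; last exact: L2CB.
rewrite us ss su !ReImE/=; lra.
Qed.

End L2Norm.

(** * The reflection [x |-> -x] and the integral *)

Section Reflection.
Context {R : realType}.
Notation mu := (@lebesgue_measure R).
Notation I := (II R).

Lemma II_opp (x : R) : I (- x) = I x.
Proof.
by apply/propext; split; rewrite /II/= !in_itv/= => /andP[? ?]; apply/andP;
  split; lra.
Qed.

Lemma measurable_reflect d (T : measurableType d) (f : R -> T) :
  measurable_fun I f -> measurable_fun I (fun x => f (- x)).
Proof.
move=> mf; apply: (@measurable_comp _ _ _ _ _ _ I f I -%R) => //.
  exact: measurable_II.
by move=> _ [x Ix <-]; rewrite II_opp.
Qed.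

(** Lebesgue measure is its own pushforward under [x |-> -x], and [I] is its own preimage. *)
Lemma ge0_integral_reflect (f : R -> \bar R) : measurable_fun I f ->
  (forall x, (0 <= f x)%E) ->
  (\int[mu]_(x in I) f (- x)%R = \int[mu]_(x in I) f x)%E.
Proof.
move=> mf f0.
have {1}-> : I = (-%R : R -> measurableTypeR R) @^-1` I.
  by apply/seteqP; split => x /=; rewrite II_opp.
rewrite -(@ge0_integral_pushforward _ _ _ (measurableTypeR R) _ _ _ mu I f)//.
by apply: eq_measure_integral => //= A mA _; exact: lebesgue_measureN.
Qed.

Lemma integral_reflect (f : R -> \bar R) : measurable_fun I f ->
  (\int[mu]_(x in I) f (- x)%R = \int[mu]_(x in I) f x)%E.
Proof.
move=> mf; rewrite integralE [RHS]integralE; congr (_ - _)%E.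
- transitivity (\int[mu]_(x in I) (f^\+)%E (- x)%R)%E.
    by apply: eq_integral => x _; rewrite !funeposE.
  by apply: ge0_integral_reflect => //; exact: measurable_funepos.
- transitivity (\int[mu]_(x in I) (f^\-)%E (- x)%R)%E.
    by apply: eq_integral => x _; rewrite !funenegE.
  by apply: ge0_integral_reflect => //; exact: measurable_funeneg.
Qed.

Lemma L2R_reflect (f : R -> R) : L2R f -> L2R (fun x => f (- x)).
Proof.
move=> [mf /integrableP[m2 i2]]; split; first exact: measurable_reflect.
apply/integrableP; split; first exact: (measurable_reflect _ _ _ m2).
rewrite (integral_reflect (fun x => `|(f x ^+ 2)%:E|%E))//.
exact: measurableT_comp.
Qed.

Lemma L2C_reflect (f : R -> R[i]) : L2C f -> L2C (fun x => f (- x)).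
Proof. by move=> [/L2R_reflect f1 /L2R_reflect f2]. Qed.

Lemma ip_reflect (f g : R -> R[i]) : L2C f -> L2C g ->
  ip (fun x => f (- x)) (fun x => g (- x)) = ip f g.
Proof.
move=> Hf Hg; have [i1 i2] := integrable_ip _ _ Hf Hg.
congr (fine _ +i* fine _).
- exact: (integral_reflect _ (measurable_int _ i1)).
- exact: (integral_reflect _ (measurable_int _ i2)).
Qed.

End Reflection.


(** * Trigonometric integrals and the three orthonormal families *)

Section TrigIntegrals.
Context {R : realType}.
Notation mu := (@lebesgue_measure R).
Notation I := (II R).
Implicit Types (f F : R -> R) (c d x : R).

(** The degenerate case [a = b] is included because [primitive_of] also tests the point [x = -1]. *)
Lemma Rintegral_FTC2 f F (a b : R) : a <= b ->
  (forall x, is_derive x 1 F (f x)) -> continuous f ->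
  \int[mu]_(x in `[a, b]) f x = F b - F a.
Proof.
rewrite le_eqVlt => /predU1P[<- _ _|ab dF cf].
  by rewrite set_itv1 Rintegral_set1 subrr.
have cF : continuous F.
  move=> x; apply: differentiable_continuous.
  by apply/derivable1_diffP; case: (dF x).
rewrite /Rintegral (@continuous_FTC2 _ f F)//.
- exact: continuous_subspaceT.
- split; first by move=> x _; case: (dF x).
  + by apply: cvg_at_right_filter; exact: cF.
  + by apply: cvg_at_left_filter; exact: cF.
- by move=> x _; rewrite derive1E; case: (dF x).
Qed.

Lemma Rintegral_II f : measurable_fun I f ->
  \int[mu]_(x in I) f x = \int[mu]_(x in `[-1, 1]) f x.
Proof.
move=> mf; have mf' : measurable_fun I (EFin \o f) by apply/measurable_EFinP.
by have := integral_itv_bndoo true false mf'; rewrite /Rintegral => ->.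
Qed.

Lemma Rintegral_II_FTC2 f F : (forall x, is_derive x 1 F (f x)) -> continuous f ->
  \int[mu]_(x in I) f x = F 1 - F (-1).
Proof.
move=> dF cf; rewrite Rintegral_II.
  by apply: Rintegral_FTC2 => //; lra.
by apply: measurable_funTS; exact: continuous_measurable_fun.
Qed.

Lemma is_derive_affine c d x : is_derive x 1 (fun x => c * x + d) c.
Proof.
have -> : (fun x => c * x + d) = (c \*: (id : R -> R)) + cst d by [].
by apply: is_derive_eq; rewrite addr0 /GRing.scale/= mulr1.
Qed.

Lemma is_derive_sin_affine c d x :
  is_derive x 1 (fun x => sin (c * x + d)) (c * cos (c * x + d)).
Proof.
apply: (is_derive_eq (@is_derive1_comp _ _ (fun x => c * x + d) _ _ _
  (is_derive_sin _) (is_derive_affine c d x))).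
by rewrite mulrC.
Qed.

Lemma is_derive_cos_affine c d x :
  is_derive x 1 (fun x => cos (c * x + d)) (- c * sin (c * x + d)).
Proof.
apply: (is_derive_eq (@is_derive1_comp _ _ (fun x => c * x + d) _ _ _
  (is_derive_cos _) (is_derive_affine c d x))).
by rewrite mulNr mulrC mulNr.
Qed.

Lemma is_deriveZl (a : R) f c x : is_derive x 1 f c ->
  is_derive x 1 (fun x => a * f x) (a * c).
Proof. by move=> df; exact: (is_deriveZ a df). Qed.

Lemma continuous_affine c d : continuous (fun x => c * x + d).
Proof.
move=> x; apply: differentiable_continuous.
by apply/derivable1_diffP; case: (is_derive_affine c d x).
Qed.

Lemma continuous_sin_affine c d : continuous (fun x => sin (c * x + d)).
Proof.
by move=> x; apply: continuous_comp; [exact: continuous_affine|exact: continuous_sin].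
Qed.

Lemma continuous_cos_affine c d : continuous (fun x => cos (c * x + d)).
Proof.
by move=> x; apply: continuous_comp; [exact: continuous_affine|exact: continuous_cos].
Qed.

Lemma continuousZ (a : R) f : continuous f -> continuous (fun x => a * f x).
Proof. by move=> cf x; apply: cvgM; [exact: cvg_cst|exact: cf]. Qed.

Lemma integral_cos_affine c d : c != 0 ->
  \int[mu]_(x in I) cos (c * x + d) = (sin (c + d) - sin (- c + d)) / c.
Proof.
move=> c0; have dF x : is_derive x 1 (fun x => c^-1 * sin (c * x + d)) (cos (c * x + d)).
  have := is_deriveZ c^-1 (is_derive_sin_affine c d x).
  by move=> H; apply: is_derive_eq; rewrite /GRing.scale/= mulKf.
rewrite (Rintegral_II_FTC2 _ _ dF); last exact: continuous_cos_affine.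
by rewrite mulr1 mulrN1 -mulrBr mulrC.
Qed.

Lemma integral_sin_affine c d : c != 0 ->
  \int[mu]_(x in I) sin (c * x + d) = (cos (- c + d) - cos (c + d)) / c.
Proof.
move=> c0; have dF x : is_derive x 1 (fun x => - c^-1 * cos (c * x + d)) (sin (c * x + d)).
  have := is_deriveZ (- c^-1) (is_derive_cos_affine c d x).
  by move=> H; apply: is_derive_eq; rewrite /GRing.scale/= mulrA mulrNN mulVf ?mul1r.
rewrite (Rintegral_II_FTC2 _ _ dF); last exact: continuous_sin_affine.
by rewrite mulr1 mulrN1 -mulrBr mulNr mulrC -mulNr opprB.
Qed.

Lemma sin_nat_pi n : sin (n%:R * pi) = 0 :> R.
Proof.
elim: n => [|n IH]; first by rewrite mul0r sin0.
by rewrite -natr1 mulrDl mul1r sinDpi IH oppr0.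
Qed.

Lemma cos_add_nat_pi (a : R) n : cos (a + n%:R * pi) = (-1) ^+ n * cos a.
Proof.
elim: n => [|n IH]; first by rewrite mul0r addr0 mul1r.
by rewrite -natr1 mulrDl mul1r addrA cosDpi IH exprS mulN1r mulNr.
Qed.

Lemma sin_int_pi (m : int) : sin (m%:~R * pi) = 0 :> R.
Proof.
case: m => n; first exact: sin_nat_pi.
by rewrite NegzE mulrNz mulNr sinN sin_nat_pi oppr0.
Qed.

Lemma integral_cis (m : int) :
  cintegral I (fun x => cis (pi * m%:~R * x)) = (if m == 0 then 2 else 0) :> R[i].
Proof.
rewrite /cintegral /cis /=; case: eqP => [->|/eqP m0].
  under eq_Rintegral do rewrite mulr0 mul0r cos0.
  under [in X in _ +i* X]eq_Rintegral do rewrite mulr0 mul0r sin0.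
  rewrite !Rintegral_II_cst mul1r mul0r/=.
  by rewrite complexr0 rmorph_nat.
have c0 : pi * m%:~R != 0 :> R by rewrite mulf_neq0 ?intr_eq0// gt_eqF// pi_gt0.
have := integral_cos_affine (pi * m%:~R) 0 c0.
have := integral_sin_affine (pi * m%:~R) 0 c0.
under eq_Rintegral do rewrite addr0.
move=> ->; under eq_Rintegral do rewrite addr0.
move=> ->; rewrite !addr0 sinN cosN subrr mul0r [pi * _]mulrC sin_int_pi.
by rewrite oppr0 subrr mul0r.
Qed.

Lemma conj_cisM (s t : R) : (cis s)^*%C * cis t = cis (t - s).
Proof.
rewrite /cis; apply: complex_ext; rewrite !ReImE/= ?cosB ?sinB; ring.
Qed.

Lemma cis_opp (s : R) : cis (- s) = (cis s)^*%C.
Proof. by rewrite /cis cosN sinN. Qed.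

Lemma cis_L2C (c : R) : L2C (fun x => cis (c * x)).
Proof.
split; apply: continuous_L2R => x.
- by have := continuous_cos_affine c 0 x; under eq_fun do rewrite addr0.
- by have := continuous_sin_affine c 0 x; under eq_fun do rewrite addr0.
Qed.

(** Only the difference of the two frequencies enters the inner product, so the half-integer shift
    in [e_a] cancels and both exponential families are covered. *)
Lemma ip_cis (a b : R) (m : int) : b - a = pi * m%:~R ->
  ip (fun x => ((Num.sqrt 2)^-1)%:C * cis (a * x))
     (fun x => ((Num.sqrt 2)^-1)%:C * cis (b * x)) = (m == 0)%:R :> R[i].
Proof.
move=> bam; have La := cis_L2C a; have Lb := cis_L2C b.
rewrite ipZr ?ipZl//; last exact: L2CZ.
have -> : ip (fun x => cis (a * x)) (fun x => cis (b * x)) = if m == 0 then 2 else 0.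
  rewrite -integral_cis /ip; congr cintegral; apply/funext => x.
  by rewrite [LHS]conj_cisM -mulrBl bam.
case: eqP => _; last by rewrite !mulr0.
rewrite mulrA; apply: complex_ext; rewrite !ReImE/=; last by ring.
rewrite !(mul0r, mulr0, subr0, addr0, oppr0) -expr2 exprVn sqr_sqrtr//.
by field.
Qed.

Lemma e_p_L2C (k : int) : L2C (e_p R k).
Proof. by apply: L2CZ; exact: cis_L2C. Qed.

Lemma e_a_L2C (k : int) : L2C (e_a R k).
Proof. by apply: L2CZ; exact: cis_L2C. Qed.

Lemma ip_e_p (j k : int) : ip (e_p R j) (e_p R k) = (j == k)%:R.
Proof.
rewrite [LHS](ip_cis _ _ (k - j)); first by rewrite subr_eq0 eq_sym.
by rewrite -mulrBr rmorphB.
Qed.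

Lemma ip_e_a (j k : int) : ip (e_a R j) (e_a R k) = (j == k)%:R.
Proof.
rewrite [LHS](ip_cis _ _ (k - j)); first by rewrite subr_eq0 eq_sym.
by rewrite -mulrBr rmorphB; congr (_ * _); ring.
Qed.

(* Since [cos 0 = 1], this normalization treats both cases of [e_N] at once. *)
Definition e_N_coef (k : nat) : R := if k is 0%N then (Num.sqrt 2)^-1 else 1.

Lemma e_NE (k : nat) x :
  e_N R k x = (e_N_coef k * cos (k%:R * pi / 2 * x + k%:R * pi / 2))%:C.
Proof.
rewrite /e_N /e_N_coef; case: k => [|k].
  by rewrite !mul0r addr0 cos0 mulr1.
by rewrite mul1r mulrDr mulr1.
Qed.

Lemma e_N_cplx (k : nat) : e_N R k =
  cplx (fun x => e_N_coef k * cos (k%:R * pi / 2 * x + k%:R * pi / 2)).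
Proof. by apply/funext => x; rewrite e_NE. Qed.

Lemma e_N_L2R (k : nat) :
  L2R (fun x => e_N_coef k * cos (k%:R * pi / 2 * x + k%:R * pi / 2)).
Proof. by apply: continuous_L2R; apply: continuousZ; exact: continuous_cos_affine. Qed.

Lemma e_N_L2C (k : nat) : L2C (e_N R k).
Proof. by rewrite e_N_cplx; apply: cplx_L2C; exact: e_N_L2R. Qed.

(** The argument of the cosine runs from [0] at [x = -1] to [m pi] at [x = 1], and the sine vanishes
    at both ends. *)
Lemma integral_cos_N (m : nat) :
  \int[mu]_(x in I) cos (m%:R * pi / 2 * x + m%:R * pi / 2) =
  (if m is 0%N then 2 else 0) :> R.
Proof.
case: m => [|m].
  under eq_Rintegral do rewrite !mul0r addr0 cos0.
  by rewrite Rintegral_II_cst mul1r.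
rewrite integral_cos_affine; last first.
  by rewrite !mulf_neq0 ?pnatr_eq0// gt_eqF// pi_gt0.
by rewrite addNr sin0 -splitr sin_nat_pi subrr mul0r.
Qed.

Lemma ip_cplx (f g : R -> R) : ip (cplx f) (cplx g) = (rip f g)%:C.
Proof.
rewrite /ip /cintegral /rip; congr (_ +i* _).
  by apply: eq_Rintegral => x _; rewrite !ReImE/=; ring.
rewrite (@eq_Rintegral _ _ _ _ _ (cst 0)) ?Rintegral_II_cst ?mul0r//.
by move=> x _; rewrite !ReImE/=; ring.
Qed.

Lemma ip_e_N (j k : nat) : ip (e_N R j) (e_N R k) = (j == k)%:R.
Proof.
(* Conjugate symmetry allows [j <= k], which makes [k - j] a true difference of naturals in the
   product-to-sum formula below. *)
wlog jk : j k / (j <= k)%N.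
  move=> H; have [/H//|/ltnW/H {}H] := leqP j k.
  by rewrite (ipJ (e_N R k)) ?H 1?eq_sym; [exact: conjc_nat|exact: e_N_L2C..].
rewrite !e_N_cplx ip_cplx /rip.
pose C (m : nat) (x : R) := cos (m%:R * pi / 2 * x + m%:R * pi / 2).
have cC m : L2R (C m) by apply: continuous_L2R; exact: continuous_cos_affine.
have c1 : L2R (cst (1 : R)) by apply: continuous_L2R => x; exact: cvg_cst.
have iC m : mu.-integrable I (EFin \o C m).
  have := integrableM_L2R _ _ (cC m) c1; apply: eq_integrable => // x _ /=.
  by rewrite mulr1.
transitivity ((e_N_coef j * e_N_coef k / 2 *
   (\int[mu]_(x in I) C (k - j)%N x + \int[mu]_(x in I) C (k + j)%N x))%:C).
  rewrite -RintegralD// -RintegralZl//; last first.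
    by have := integrableD measurable_II (iC (k - j)%N) (iC (k + j)%N).
  congr (_%:C); apply: eq_Rintegral => x _.
  have -> : C (k - j)%N x = cos ((k%:R * pi / 2 * x + k%:R * pi / 2) -
    (j%:R * pi / 2 * x + j%:R * pi / 2)).
    by rewrite /C natrB//; congr cos; ring.
  have -> : C (k + j)%N x = cos ((k%:R * pi / 2 * x + k%:R * pi / 2) +
    (j%:R * pi / 2 * x + j%:R * pi / 2)).
    by rewrite /C natrD; congr cos; ring.
  set v := _ + j%:R * pi / 2; set u := _ + k%:R * pi / 2.
  rewrite (cosB u v) (cosD u v).
  move: (cos u) (cos v) (sin u) (sin v) => p q r s.
  by move: (e_N_coef j) (e_N_coef k) => a b; field.
(* For [j < k] both integrals vanish. For [j = k > 0] only the one of index [k - j] survives, giving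
   [1/2 * 2]; for [j = k = 0] both survive, and the coefficient [1/2 * 1/2] compensates for the sum
   [4]. *)
rewrite !integral_cos_N; move: jk; rewrite leq_eqVlt => /predU1P[<-|jk].
  rewrite subnn eqxx; case: j => [|j] /=; last first.
    by rewrite !mul1r addr0 mulVf.
  rewrite -expr2 exprVn sqr_sqrtr//.
  by rewrite (_ : 2^-1 / 2 * (2 + 2) = 1 :> R)//; field.
rewrite (ltn_eqF jk); have [m ->] : exists m, (k - j = m.+1)%N.
  by exists (k - j).-1; rewrite prednK// subn_gt0.
have [n ->] : exists n, (k + j = n.+1)%N.
  by exists (k + j).-1; rewrite prednK// addn_gt0 (leq_ltn_trans _ jk).
by rewrite addr0 mulr0.
Qed.

(** * From exponentials to eigenfunctions of [A_N] *)

Lemma e_p_reflect (k : int) x : e_p R (- k) x = e_p R k (- x).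
Proof. by rewrite /e_p mulrNz mulrN mulNr mulrN. Qed.

Lemma e_a_reflect (k : int) x : e_a R (- k - 1) x = e_a R k (- x).
Proof. by rewrite /e_a; congr (_ * cis _); rewrite rmorphB rmorphN/=; field. Qed.

Let half_sqrt2 : (Num.sqrt 2)^-1 * 2 = Num.sqrt 2 :> R.
Proof.
have s0 : Num.sqrt 2 != 0 :> R by rewrite gt_eqF// sqrtr_gt0.
by rewrite -{2}(@sqr_sqrtr R 2)// expr2 mulrA mulVf ?mul1r.
Qed.

(** The two terms are conjugate, so they add up to [sqrt 2 * cos (pi j x)]; the sign [(-1)^j] comes
    from the shift by [j pi] in the eigenfunction. At [j = 0] the normalization of [e_N] is a
    different one. *)
Lemma e_p_even (j : nat) x : (0 < j)%N ->
  e_p R j x + e_p R (- j%:Z) x = (Num.sqrt 2 * (-1) ^+ j)%:C * e_N R (j * 2) x.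
Proof.
move=> j0; rewrite e_p_reflect e_NE /e_p mulrN cis_opp.
have -> : e_N_coef (j * 2) = 1 by case: j j0.
have -> : (j * 2)%:R * pi / 2 * x + (j * 2)%:R * pi / 2 = pi * j%:R * x + j%:R * pi :> R.
  by rewrite natrM; field.
rewrite cos_add_nat_pi /cis.
apply: complex_ext; rewrite !ReImE/=; last by ring.
have jE : (j%:Z)%:~R = j%:R :> R by [].
rewrite -signr_odd ?jE; move: half_sqrt2.
move: ((Num.sqrt (2 : R))^-1) => t; move: (Num.sqrt (2 : R)) => s <-.
by case: (odd j) => /=; rewrite ?expr1 ?expr0; ring.
Qed.

(** The two terms are conjugate, so their difference is [i sqrt 2] times a sine. In the
    eigenfunction of index [2 j + 1] the shift by [pi / 2 + j pi] turns the cosine into [-(-1)^j]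
    times the same sine. *)
Lemma e_a_odd (j : nat) x :
  e_a R j x - e_a R (- j%:Z - 1) x =
  (0 -i* (Num.sqrt 2 * (-1) ^+ j)) * e_N R (j * 2).+1 x.
Proof.
rewrite e_a_reflect e_NE /e_a mulrN cis_opp mul1r.
have -> : (j * 2).+1%:R * pi / 2 * x + (j * 2).+1%:R * pi / 2 =
    (pi * (j%:R + 2^-1) * x + pi / 2) + j%:R * pi :> R.
  by rewrite -natr1 natrM; field.
rewrite cos_add_nat_pi cosDpihalf /cis.
apply: complex_ext; rewrite !ReImE/=; first by ring.
have jE : (j%:Z)%:~R = j%:R :> R by [].
rewrite -signr_odd ?jE; move: half_sqrt2.
move: ((Num.sqrt (2 : R))^-1) => t; move: (Num.sqrt (2 : R)) => s <-.
by case: (odd j) => /=; rewrite ?expr1 ?expr0; ring.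
Qed.

Lemma e_p0 : e_p R 0 = e_N R 0.
Proof.
apply/funext => x; rewrite /e_p /e_N mulr0 mul0r /cis cos0 sin0.
by apply: complex_ext; rewrite !ReImE/=; ring.
Qed.

Lemma A_N_e_N (k : nat) : A_N R (e_N R k) (fun x => (lam_N R k)%:C * e_N R k x).
Proof.
pose c : R := k%:R * pi / 2; pose a := e_N_coef k.
have prim (f F : R -> R) : (forall x, is_derive x 1 F (f x)) -> continuous f ->
    primitive_of (cplx f) (cplx F).
  move=> dF cf x; rewrite in_itv/= => /andP[x1 _].
  rewrite /cintegral /= (Rintegral_FTC2 f F)// Rintegral_cst// mul0r.
  by apply: complex_ext => /=; ring.
split; [exact: e_N_L2C|exact/L2CZ/e_N_L2C|].
(* The witnesses are the eigenfunction and its first two derivatives. The first derivative is a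
   multiple of [sin (c x + c)], whose argument is [0] and [k pi] at the endpoints, which is the
   Neumann condition. *)
exists (e_N R k), (cplx (fun x => a * (- c * sin (c * x + c)))),
  (cplx (fun x => a * (- c * (c * cos (c * x + c))))); split; split.
- exact: aeW.
- rewrite e_N_cplx; apply: prim.
    by move=> x; exact: (is_deriveZl a _ _ _ (is_derive_cos_affine c c x)).
  by do 2 apply: continuousZ; exact: continuous_sin_affine.
- apply: prim.
    by move=> x; do 2 apply: is_deriveZl; exact: is_derive_sin_affine.
  by do 3 apply: continuousZ; exact: continuous_cos_affine.
- apply: cplx_L2C; apply: continuous_L2R.
  by do 3 apply: continuousZ; exact: continuous_cos_affine.
- by rewrite /cplx mulrN1 addNr sin0 !mulr0.
- by rewrite /cplx mulr1 /c -splitr sin_nat_pi !mulr0.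
- apply: aeW => x _; rewrite e_NE /cplx -!rmorphM/=; congr (_%:C).
  rewrite /lam_N -/c -/a natrX.
  have p0 : pi != 0 :> R by rewrite gt_eqF// pi_gt0.
  move: (cos _) a => z b; rewrite /c.
  by move: p0; move: (@pi R) => p p0; field.
Qed.

End TrigIntegrals.


(** * Powers approximating a step at [1/2] *)

Section StepLimit.
Context {R : realType}.
Implicit Types (x y s : R).

Lemma bernoulli_le y m : 0 <= y -> 1 + m%:R * y <= (1 + y) ^+ m.
Proof.
move=> y0; elim: m => [|m IH]; first by rewrite mul0r addr0 expr0.
rewrite exprS; apply: (@le_trans _ _ ((1 + y) * (1 + m%:R * y))); last first.
  by rewrite ler_wpM2l// addr_ge0.
have : 0 <= m%:R * y * y by rewrite !mulr_ge0.
by rewrite -natr1; lra.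
Qed.

Lemma bernoulli_ge y m : 0 <= y <= 1 -> 1 - m%:R * y <= (1 - y) ^+ m.
Proof.
move=> /andP[y0 y1]; elim: m => [|m IH]; first by rewrite mul0r subr0 expr0.
rewrite exprS; apply: (@le_trans _ _ ((1 - y) * (1 - m%:R * y))); last first.
  by rewrite ler_wpM2l// subr_ge0.
have : 0 <= m%:R * y * y by rewrite !mulr_ge0.
by rewrite -natr1; lra.
Qed.

(* Bernoulli's inequality gives the bounds [1 - (2 s)^n] from below and
   [(2 s)^-n] from above, hence the limit [1] for [s < 1/2] and [0] for [s > 1/2]. *)
Definition step_approx s n : R := (1 - s ^+ n) ^+ (2 ^ n).

Lemma step_approx_itv s n : 0 <= s <= 1 -> 0 <= step_approx s n <= 1.
Proof.
move=> /andP[s0 s1]; have sn0 : 0 <= s ^+ n by rewrite exprn_ge0.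
have sn1 : s ^+ n <= 1 by rewrite exprn_ile1.
by rewrite /step_approx exprn_ge0 ?exprn_ile1 ?subr_ge0// lerBlDr lerDl.
Qed.

Lemma step_approx_cvg1 s : 0 <= s < 2^-1 -> step_approx s n @[n --> \oo] --> (1 : R).
Proof.
move=> /andP[s0 s2]; have s1 : 0 <= s <= 1 by apply/andP; split; lra.
apply: (@squeeze_cvgr _ _ _ _ (fun n => 1 - (2 * s) ^+ n) (cst 1)).
- apply: nearW => n; rewrite (andP (step_approx_itv s n s1)).2 andbT.
  rewrite exprMn -natrX; apply: bernoulli_ge.
  by rewrite exprn_ge0// exprn_ile1//; lra.
- rewrite -[X in _ --> X]subr0; apply: cvgB; first exact: cvg_cst.
  by apply: cvg_expr; rewrite ger0_norm; lra.
- exact: cvg_cst.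
Qed.

Lemma step_approx_cvg0 s : 2^-1 < s <= 1 -> step_approx s n @[n --> \oo] --> (0 : R).
Proof.
move=> /andP[s2 s1]; have s01 : 0 <= s <= 1 by apply/andP; split; lra.
have s0 : 0 < 2 * s by lra.
apply: (@squeeze_cvgr _ _ _ _ (cst 0) (fun n => (2 * s)^-1 ^+ n)).
- apply: nearW => n; rewrite (andP (step_approx_itv s n s01)).1/=.
  rewrite exprVn -[leRHS]mul1r ler_pdivlMr ?exprn_gt0//.
  have sn0 : 0 <= s ^+ n by rewrite exprn_ge0//; lra.
  have sn1 : s ^+ n <= 1 by rewrite exprn_ile1//; lra.
  (* By Bernoulli, [(2 s)^n] is at most [(1 + s^n)^(2^n)]. The product with [step_approx s n] is
     then [(1 - s^(2 n))^(2^n)], which is at most [1]. *)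
  apply: (@le_trans _ _ ((1 - s ^+ n) ^+ (2 ^ n) * (1 + s ^+ n) ^+ (2 ^ n))).
    rewrite /step_approx ler_wpM2l ?exprn_ge0 ?subr_ge0//.
    apply: le_trans (bernoulli_le _ _ sn0).
    by rewrite exprMn -natrX lerDr.
  rewrite -exprMn; apply: exprn_ile1; have : 0 <= s ^+ n * s ^+ n by rewrite mulr_ge0.
    have : s ^+ n * s ^+ n <= 1 by rewrite mulr_ile1.
    lra.
  lra.
- exact: cvg_cst.
- apply: cvg_expr; rewrite ger0_norm ?invr_ge0 ?ltW// invf_lt1//; lra.
Qed.

End StepLimit.

(** * Density of the polynomials in [cos (pi (x + 1) / 2)] *)

Section CosinePolynomials.
Import HBNNSimple.
Context {R : realType}.
Notation mu := (@lebesgue_measure R).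
Notation I := (II R).
Implicit Types (f g : R -> R) (p q : {poly R}).

Definition rsq f := rip f f.

Lemma rsq_ge0 f : 0 <= rsq f.
Proof. by apply: Rintegral_ge0 => x _; rewrite -expr2 sqr_ge0. Qed.

Lemma rsqD_le f g : L2R f -> L2R g ->
  rsq (fun x => f x + g x) <= 2 * rsq f + 2 * rsq g.
Proof.
move=> Hf Hg.
suff : rsq (fun x => f x + g x) + rsq (fun x => f x - g x) = 2 * rsq f + 2 * rsq g.
  by move=> <-; rewrite lerDl rsq_ge0.
have Hd := L2RD _ _ Hf Hg; have Hb := L2RB _ _ Hf Hg.
rewrite /rsq ripBl// !ripBr// ripDl// !ripDr// (ripC g f).
by ring.
Qed.

Lemma rsqZ a f : L2R f -> rsq (fun x => a * f x) = a ^+ 2 * rsq f.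
Proof. by move=> Hf; rewrite /rsq ripZl ?ripZr ?mulrA//; exact: L2RZ. Qed.

Definition cosv (x : R) : R := cos (pi / 2 * x + pi / 2).

Lemma cosvE x : cosv x = cos (pi / 2 * (x + 1)).
Proof. by rewrite mulrDr mulr1. Qed.

Lemma cosv_itv x : -1 <= cosv x <= 1.
Proof. by rewrite cos_geN1 cos_le1. Qed.

Lemma continuous_poly_cosv p : continuous (fun x => p.[cosv x]).
Proof.
move=> x; apply: (@continuous_comp _ _ _ cosv (horner p)).
  exact: continuous_cos_affine.
exact: continuous_horner.
Qed.

Lemma poly_cosv_L2R p : L2R (fun x => p.[cosv x]).
Proof. by apply: continuous_L2R; exact: continuous_poly_cosv. Qed.

(** Membership in the [L^2] closure of the polynomials in [cosv]. The [L2R] component is included so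
    that the closure properties chain without side conditions. *)
Definition cos_approx f := L2R f /\ forall eps : R, 0 < eps ->
  exists p, rsq (fun x => f x - p.[cosv x]) < eps.

Lemma cos_approx_poly p : cos_approx (fun x => p.[cosv x]).
Proof.
split; first exact: poly_cosv_L2R.
move=> eps e0; exists p; rewrite /rsq /rip.
rewrite (@eq_Rintegral _ _ _ _ _ (cst 0)) ?Rintegral_II_cst ?mul0r//.
by move=> x _; rewrite subrr mul0r.
Qed.

Lemma cos_approx_cst (c : R) : cos_approx (fun=> c).
Proof. by have := cos_approx_poly c%:P; under eq_fun do rewrite hornerC. Qed.

Lemma cos_approxD f g : cos_approx f -> cos_approx g ->
  cos_approx (fun x => f x + g x).
Proof.
move=> [Hf af] [Hg ag]; split; first exact: L2RD.
move=> eps e0; have e4 : 0 < eps / 4 by lra.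
have [p Hp] := af _ e4; have [q Hq] := ag _ e4; exists (p + q).
have -> : (fun x => f x + g x - (p + q).[cosv x]) =
    (fun x => (f x - p.[cosv x]) + (g x - q.[cosv x])).
  by apply/funext => x; rewrite hornerD; ring.
have := rsqD_le _ _ (L2RB _ _ Hf (poly_cosv_L2R p)) (L2RB _ _ Hg (poly_cosv_L2R q)).
lra.
Qed.

Lemma cos_approxZ a f : cos_approx f -> cos_approx (fun x => a * f x).
Proof.
move=> [Hf af]; split; first exact: L2RZ.
move=> eps e0; have e1 : 0 < eps / (1 + a ^+ 2).
  by rewrite divr_gt0// ltr_pwDl// sqr_ge0.
have [p Hp] := af _ e1; exists (a *: p).
have -> : (fun x => a * f x - (a *: p).[cosv x]) = (fun x => a * (f x - p.[cosv x])).
  by apply/funext => x; rewrite hornerZ mulrBr.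
rewrite rsqZ; last exact: L2RB (poly_cosv_L2R p).
move: Hp; rewrite ltr_pdivlMr ?ltr_pwDl ?sqr_ge0//.
have := rsq_ge0 (fun x => f x - p.[cosv x]); lra.
Qed.

Lemma cos_approx_sum (K : Type) (J : seq K) (f : K -> R -> R) :
  (forall k, cos_approx (f k)) -> cos_approx (fun x => \sum_(k <- J) f k x).
Proof.
move=> Hf; elim: J => [|k J IH].
  by under eq_fun do rewrite big_nil; exact: cos_approx_cst.
by under eq_fun do rewrite big_cons; exact: cos_approxD.
Qed.

Lemma cos_approx_closed f : L2R f ->
  (forall eps : R, 0 < eps -> exists2 g, cos_approx g & rsq (fun x => f x - g x) < eps) ->
  cos_approx f.
Proof.
move=> Hf Hg; split=> // eps e0; have e4 : 0 < eps / 4 by lra.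
have [g [Lg ag] fg] := Hg _ e4; have [p gp] := ag _ e4; exists p.
have -> : (fun x => f x - p.[cosv x]) = (fun x => (f x - g x) + (g x - p.[cosv x])).
  by apply/funext => x; ring.
have := rsqD_le _ _ (L2RB _ _ Hf Lg) (L2RB _ _ Lg (poly_cosv_L2R p)).
lra.
Qed.

(** Dominated convergence, applied to the squared errors with majorant [G], turns pointwise
    convergence into [L^2] convergence. Rays, countable disjoint unions and monotone limits of
    simple functions are all reached this way. *)
Lemma cos_approx_limit (f_ : nat -> R -> R) f (G : R -> R) :
  (forall n, cos_approx (f_ n)) -> L2R f ->
  {ae mu, forall x, I x -> f_ n x @[n --> \oo] --> f x} ->
  mu.-integrable I (EFin \o G) ->
  (forall n x, I x -> (f x - f_ n x) ^+ 2 <= G x) ->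
  cos_approx f.
Proof.
move=> Hn Hf f_f iG fG; apply: cos_approx_closed => // eps e0.
have md n : measurable_fun I (fun x => ((f x - f_ n x) ^+ 2)%:E).
  apply/measurable_EFinP/measurable_funX.
  by apply: measurable_funB; [case: Hf|case: (Hn n) => -[]].
have [] := @dominated_convergence _ _ R mu I measurable_II
  (fun n x => ((f x - f_ n x) ^+ 2)%:E) (cst 0%E) (EFin \o G) md.
- exact: measurable_cst.
- move: f_f; apply: (@filterS _ _ (ae_filter_ringOfSetsType mu)) => x fx Ix.
  apply: cvg_EFin; first exact: nearW.
  (* The limit [0] is written as [(f x - f x) * (f x - f x)] to match the limit of a product. *)
  rewrite -(mulr0 0) -{2}(subrr (f x)) -{1}(subrr (f x)).
  under eq_fun do rewrite /= expr2.
  by apply: cvgM; (apply: cvgB; [exact: cvg_cst|exact: fx]).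
- exact: iG.
- apply: aeW => x n Ix; rewrite lee_fin ger0_norm ?sqr_ge0//; exact: fG.
move=> _ _; rewrite integral0 => /fine_cvg/cvgrPdist_lt/(_ _ e0)[N _ HN].
exists (f_ N) => //; have := HN N (leqnn N).
rewrite sub0r normrN => /(le_lt_trans (ler_norm _)).
suff -> : rsq (fun x => f x - f_ N x) =
  fine (\int[mu]_(x in I) ((f x - f_ N x) ^+ 2)%:E) by [].
by apply: eq_Rintegral => x _; rewrite expr2.
Qed.

Lemma indic_L2R (S : set R) : measurable S -> L2R (\1_S : R -> R).
Proof.
move=> mS; apply: (@bounded_L2R _ _ 1).
  by apply: measurable_funTS; exact: measurable_indic.
by move=> x _; rewrite indicE ger0_norm// lern1 leq_b1.
Qed.

(** On [[-1, 1]] the argument of the cosine stays in [[0, pi]], where the cosine is strictly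
    decreasing. *)
Lemma cosv_lt (c x : R) : -1 <= c <= 1 -> -1 <= x <= 1 -> (cosv x < cosv c) = (c < x).
Proof.
move=> hc hx; have p0 := pi_gt0 R; have p2 : 0 <= pi / 2 :> R by rewrite divr_ge0 ?pi_ge0.
rewrite !cosvE ltr_cos ?in_itv/=.
- by rewrite ltr_pM2l ?divr_gt0// ltrD2r.
- apply/andP; split; first by rewrite mulr_ge0//; lra.
  have : pi / 2 * (c + 1) <= pi / 2 * 2 by rewrite ler_wpM2l//; lra.
  by rewrite divfK.
- apply/andP; split; first by rewrite mulr_ge0//; lra.
  have : pi / 2 * (x + 1) <= pi / 2 * 2 by rewrite ler_wpM2l//; lra.
  by rewrite divfK.
Qed.

Lemma cos_approx_eq f g : L2R f -> {in I, f =1 g} -> cos_approx g -> cos_approx f.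
Proof.
move=> Hf fg [Lg ag]; split=> // eps /ag[p gp]; exists p; move: gp.
suff -> : rsq (fun x => f x - p.[cosv x]) = rsq (fun x => g x - p.[cosv x]) by [].
by apply: eq_Rintegral => x xI; rewrite fg.
Qed.

Lemma cos_approx_ray (c : R) : cos_approx (\1_(`]c, +oo[%classic) : R -> R).
Proof.
have mr : measurable (`]c, +oo[%classic : set R) by exact: measurable_itv.
have LS := indic_L2R _ mr.
(* When [c] lies outside [I] the indicator is constant on [I]. *)
have [c1|c1] := leP c (-1).
  apply: cos_approx_eq (cos_approx_cst 1) => // x /set_mem.
  rewrite /II/= in_itv/= => /andP[x1 _].
  by rewrite indicE mem_set//= in_itv/= andbT; lra.
have [c2|c2] := leP 1 c.
  apply: cos_approx_eq (cos_approx_cst 0) => // x /set_mem.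
  rewrite /II/= in_itv/= => /andP[_ x1].
  by rewrite indicE memNset//= in_itv/= andbT; apply/negP; lra.
have hc : -1 <= c <= 1 by lra.
(* This affine function of [cosv x] passes through [1/2] at [x = c] and is below [1/2] to the right
   of [c]. Since [cosv x - cosv c] is at most [2] in absolute value, the divisor [4] keeps [s] in
   [[0, 1]]. *)
pose s x := 2^-1 + (cosv x - cosv c) / 4.
have s01 x : 0 <= s x <= 1.
  have := cosv_itv x; have := cosv_itv c; rewrite /s => /andP[? ?] /andP[? ?].
  by apply/andP; split; lra.
have [sp spE] : exists sp : {poly R}, forall x, sp.[cosv x] = s x.
  exists ((2^-1 - cosv c / 4)%:P + 4^-1 *: 'X) => x.
  by rewrite !hornerE /s; field.
apply: (@cos_approx_limit (fun n x => step_approx (s x) n) _ (cst 1)) => //.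
- move=> n; have := cos_approx_poly ((1 - sp ^+ n) ^+ (2 ^ n)).
  by under eq_fun do rewrite !hornerE spE.
(* Only at [x = c], where [s] equals [1/2], is the limit of the steps not controlled; this point is
   a null set. *)
- exists [set c]; split; [exact: measurable_set1|exact: lebesgue_measure_set1|].
  move=> x /= H; apply: contrapT => xc; apply: H; rewrite /II /= in_itv/= => /andP[x1 x2].
  have hx : -1 <= x <= 1 by lra.
  have [cx|xlec] := ltP c x.
    rewrite indicE mem_set/= ?in_itv/= ?cx//.
    apply: step_approx_cvg1; rewrite (andP (s01 x)).1/=.
    have : cosv x < cosv c by rewrite cosv_lt.
    by rewrite /s; lra.
  have ltxc : x < c by rewrite lt_neqAle xlec andbT; apply/eqP.
  rewrite indicE memNset/=; last by rewrite in_itv/= andbT; apply/negP; rewrite -leNgt.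
  apply: step_approx_cvg0; rewrite (andP (s01 x)).2 andbT.
  have : cosv c < cosv x by rewrite cosv_lt.
  by rewrite /s; lra.
- exact: integrable_cst_II.
- move=> n x _ /=; have := step_approx_itv (s x) n (s01 x).
  set t := step_approx _ _ => /andP[t0 t1]; rewrite indicE.
  by case: (_ \in _) => /=; rewrite expr2; nra.
Qed.

(** Dynkin's lemma for the rays []a, +oo[], which are stable under intersection and generate the
    Borel sets. Complements follow from linearity, disjoint unions from the limit of partial sums of
    indicators. *)
Lemma cos_approx_indic (S : set R) : measurable S -> cos_approx (\1_S : R -> R).
Proof.
move=> mS; have : <<s @RGenOInfty.G R >> S.
  suff : (@RGenOInfty.G R).-sigma.-measurable S by [].
  by rewrite -RGenOInfty.measurableE.
move: S {mS}; apply: (@dynkin_induction _ (measurableTypeR R) (@RGenOInfty.G R)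
  (fun S => cos_approx (\1_S)) (RGenOInfty.measurableE R)).
- move=> _ _ [a ->] [b ->]; exists (Num.max a b).
  apply/seteqP; split => x /=; rewrite !in_itv/= !andbT gt_max.
    by case=> -> ->.
  by move=> /andP[].
- by rewrite indicT; exact: cos_approx_cst.
- by move=> _ [a ->]; exact: cos_approx_ray.
- move=> S mS aS; have -> : \1_(~` S) = (fun x => 1 + (-1) * \1_S x) :> (R -> R).
    by apply/funext => x; rewrite !indicE in_setC; case: (_ \in _) => /=; ring.
  by apply: cos_approxD; [exact: cos_approx_cst|exact: cos_approxZ].
- move=> F mF tF aF.
  have sumE n x k : (k < n)%N -> F k x -> \sum_(j <- iota 0 n) \1_(F j) x = 1 :> R.
    move=> kn Fkx; rewrite (bigD1_seq k) ?mem_iota ?iota_uniq//= indicE mem_set//=.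
    rewrite big1 ?addr0// => j jk; rewrite indicE memNset// => Fjx.
    by move/eqP: jk; apply; apply: (tF j k) => //; exists x.
  have sum0 n x : ~ (\bigcup_k F k) x -> \sum_(j <- iota 0 n) \1_(F j) x = 0 :> R.
    move=> nF; rewrite big1// => j _; rewrite indicE memNset// => Fjx.
    by apply: nF; exists j.
  apply: (@cos_approx_limit (fun n x => \sum_(j <- iota 0 n) \1_(F j) x) _ (cst 1)).
  + by move=> n; exact: cos_approx_sum.
  + by apply: indic_L2R; apply: bigcup_measurable => k _; exact: mF.
  + apply: aeW => x _; have [[k _ Fkx]|nF] := pselect ((\bigcup_k F k) x).
      apply: cvg_near_cst; exists k.+1 => // n /= kn.
      by rewrite (sumE _ _ k)// indicE mem_set//; exists k.
    by apply: cvg_near_cst; apply: nearW => n; rewrite sum0// indicE memNset.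
  + exact: integrable_cst_II.
  (* For [x] in [F k] the partial sum is [1] once [n > k] and [0] before; outside the union it is
     [0]. The squared error is therefore [0] or [1]. *)
  + move=> n x _ /=; have [[k _ Fkx]|nF] := pselect ((\bigcup_k F k) x).
      rewrite (@indicE _ _ (\bigcup_k F k)) mem_set//=; last by exists k.
      have [kn|nk] := ltnP k n; first by rewrite (sumE _ _ k)// subrr expr2 mul0r.
      rewrite big1_seq ?subr0 ?expr1n// => j; rewrite mem_iota => /andP[_ jn].
      rewrite indicE memNset// => Fjx; have : j = k by apply: (tF j k) => //; exists x.
      by move=> jk; move: jn; rewrite jk add0n ltnNge nk.
    by rewrite sum0// indicE memNset// subrr expr2 mul0r.
Qed.

Lemma cos_approx_nnsfun (h : {nnsfun measurableTypeR R >-> R}) :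
  cos_approx (fun x : R => h x).
Proof.
have -> : (fun x : R => h x) = (fun x =>
    \sum_(y <- fset_set (range h)) (y * \1_(h @^-1` [set y]) x)) :> (R -> R).
  by apply/funext => x; rewrite fimfunE fsbig_finite.
apply: cos_approx_sum => y; apply: cos_approxZ; apply: cos_approx_indic.
have mh : measurable_fun [set: measurableTypeR R] h by exact: measurable_funP.
by have := mh measurableT _ (measurable_set1 y); rewrite setTI.
Qed.

(** Simple functions [g n] increase to [f]; as [0 <= g n <= f], the squared errors are dominated by
    [f^2]. *)
Lemma cos_approx_ge0 f : L2R f -> (forall x, 0 <= f x) -> cos_approx f.
Proof.
move=> Hf f0; have [mf if2] := Hf.
have mfE : measurable_fun I (EFin \o f) by apply/measurable_EFinP.
have [|g [ndg gf]] := approximation measurable_II mfE.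
  by move=> x _; rewrite lee_fin.
have gcvg x : I x -> g n x @[n --> \oo] --> f x.
  by move=> /gf /fine_cvg; apply.
apply: (@cos_approx_limit g _ (fun x => f x ^+ 2)) => //.
- by move=> n; exact: cos_approx_nnsfun.
- by apply: aeW => x; exact: gcvg.
- move=> n x Ix; have g0 : 0 <= g n x by [].
  have gfx : g n x <= f x.
    have -> : f x = limn (g ^~ x) by apply/esym/cvg_lim => //; exact: gcvg.
    apply: (nondecreasing_cvgn_le (u_ := g ^~ x)).
      by move=> i j ij; have /lefP := ndg i j ij; apply.
    by apply/cvg_ex; exists (f x); exact: gcvg.
  by have := f0 x; rewrite !expr2; nra.
Qed.

Lemma cos_approx_L2R f : L2R f -> cos_approx f.
Proof.
move=> Hf; have [mf if2] := Hf.
have -> : f = (fun x => Num.max (f x) 0 + (-1) * Num.max (- f x) 0).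
  apply/funext => x; rewrite mulN1r; have [fx|fx] := leP (f x) 0.
    by rewrite max_l ?oppr_ge0// add0r opprK.
  by rewrite max_r ?subr0// oppr_le0 ltW.
have Hmax g : L2R g -> L2R (fun x => Num.max (g x) 0).
  move=> [mg ig]; split; first by apply: measurable_maxr.
  apply: le_integrable ig => //.
    by apply/measurable_EFinP/measurable_funX/measurable_maxr.
  move=> x _ /=; rewrite lee_fin !ger0_norm ?sqr_ge0//.
  by have [gx|gx] := leP (g x) 0; rewrite // expr0n sqr_ge0.
apply: cos_approxD; last apply: cos_approxZ.
- by apply: cos_approx_ge0 => [|x]; [exact: Hmax|rewrite le_max lexx orbT].
- apply: cos_approx_ge0 => [|x]; last by rewrite le_max lexx orbT.
  by apply: (Hmax (fun x => - f x)); exact: L2RN.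
Qed.

End CosinePolynomials.


(** * Completeness of the eigenfunctions of [A_N] *)

Section NeumannBasis.
Context {R : realType}.
Notation mu := (@lebesgue_measure R).
Notation I := (II R).

Definition cos_comb (s : seq (R * nat)) (y : R) : R :=
  \sum_(q <- s) q.1 * cos (q.2%:R * y).

Lemma cos_comb_mul_cos s : exists s', forall y, cos y * cos_comb s y = cos_comb s' y.
Proof.
elim: s => [|[a k] s [s' IH]].
  by exists [::] => y; rewrite /cos_comb !big_nil mulr0.
(* From [2 cos y cos (k y) = cos ((k + 1) y) + cos ((k - 1) y)]. For [k = 0] the second frequency is
   [|k - 1| = 1], so the two halves recombine to [a * cos y]. *)
exists [:: (a / 2, k.+1), (a / 2, if k is k'.+1 then k' else 1%N) & s'] => y.
rewrite /cos_comb !big_cons/= mulrDr; rewrite -/(cos_comb s y) -/(cos_comb s' y) IH.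
rewrite addrA; congr (_ + _).
case: k => [|k].
  by rewrite !mul0r cos0 !mul1r; field.
have -> : k.+2%:R * y = k.+1%:R * y + y by rewrite -(natr1 k.+1) mulrDl mul1r.
have -> : k%:R * y = k.+1%:R * y - y by rewrite -(natr1 k) mulrDl mul1r addrK.
rewrite cosD cosB; move: (cos (k.+1%:R * y)) (sin (k.+1%:R * y)) (cos y) (sin y) => A B C D.
by field.
Qed.

Lemma poly_cos_comb (p : {poly R}) : exists s, forall y, p.[cos y] = cos_comb s y.
Proof.
elim/poly_ind: p => [|p c [s IH]].
  by exists [::] => y; rewrite /cos_comb horner0 big_nil.
have [s' Hs'] := cos_comb_mul_cos s.
exists ((c, 0%N) :: s') => y; rewrite hornerMXaddC IH mulrC Hs'.
by rewrite /cos_comb big_cons/= mul0r cos0 mulr1 addrC.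
Qed.

Lemma e_N_coef_neq0 k : e_N_coef k != 0 :> R.
Proof.
case: k => [|k] /=; last exact: oner_neq0.
by rewrite invr_eq0 gt_eqF// sqrtr_gt0.
Qed.

(** A list may repeat an index, whereas [hilbert_basis] asks for a finite set and a coefficient
    function, so the coefficients of equal indices are collected. *)
Lemma finite_comb_fset (e : nat -> R -> R[i]) (s : seq (R[i] * nat)) :
  exists (J : {fset nat}) (c : nat -> R[i]), forall x,
    \sum_(q <- s) q.1 * e q.2 x = \sum_(k <- J) c k * e k x.
Proof.
exists [fset q.2 | q in s]%fset, (fun k => \sum_(q <- s | q.2 == k) q.1) => x.
under [RHS]eq_bigr do rewrite mulr_suml.
rewrite (exchange_big_dep xpredT)//=; apply: eq_big_seq => q qs.
rewrite -big_filter (eq_filter (a2 := pred1 q.2)); last by move=> k /=; rewrite eq_sym.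
rewrite filter_pred1_uniq ?fset_uniq ?big_seq1//.
by apply/imfsetP; exists q.
Qed.

Lemma hilbert_basis_e_N : hilbert_basis (e_N R).
Proof.
split; [exact: e_N_L2C|exact: ip_e_N|].
move=> u Lu eps e0; have [Lr Li] := Lu.
have e2 : 0 < eps ^+ 2 / 2 by rewrite divr_gt0 ?exprn_gt0.
have [_ /(_ _ e2)[p Hp]] := cos_approx_L2R _ Lr.
have [_ /(_ _ e2)[q Hq]] := cos_approx_L2R _ Li.
have [s Hs] := poly_cos_comb p; have [t Ht] := poly_cos_comb q.
pose g x : R[i] := p.[cosv x] +i* q.[cosv x].
(* The expansion of [p] supplies real coefficients and that of [q] imaginary ones; dividing by
   [e_N_coef] undoes the normalization of [e_N]. *)
pose w := [seq ((r.1 / e_N_coef r.2)%:C, r.2) | r <- s] ++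
          [seq (0 +i* (r.1 / e_N_coef r.2), r.2) | r <- t].
have argE k x : k%:R * pi / 2 * x + k%:R * pi / 2 = k%:R * (pi / 2 * x + pi / 2) :> R.
  by move: (@pi R) => z; field.
have [J [c Hc]] := finite_comb_fset (e_N R) w.
exists J, c.
have -> : (fun x => u x - \sum_(k <- J) c k * e_N R k x) =
    (fun x => u x - g x).
  apply/funext => x; rewrite -Hc; congr (_ - _).
  rewrite big_cat !big_map/= /g /cosv Hs Ht /cos_comb.
  apply: complex_ext.
  + rewrite cReD !Re_sum/= [X in _ + X]big1 ?addr0; last first.
      by move=> r _; rewrite e_NE !ReImE/=; ring.
    apply: eq_bigr => r _; rewrite e_NE !ReImE/= mul0r subr0 mulrA divfK ?e_N_coef_neq0//.
    by rewrite argE.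
  + rewrite cImD !Im_sum/= [X in X + _]big1 ?add0r; last first.
      by move=> r _; rewrite e_NE !ReImE/=; ring.
    apply: eq_bigr => r _; rewrite e_NE !ReImE/= mul0r add0r mulrA divfK ?e_N_coef_neq0//.
    by rewrite argE.
have Lg : L2C g by split => /=; exact: poly_cosv_L2R.
rewrite L2norm_ltE// /L2sq ipE /=; try exact: L2CB.
suff : rsq (fun x => complex.Re (u x - g x)) +
  rsq (fun x => complex.Im (u x - g x)) < eps ^+ 2 by [].
have -> : (fun x => complex.Re (u x - g x)) = (fun x => complex.Re (u x) - p.[cosv x]).
  by apply/funext => x; rewrite !ReImE.
have -> : (fun x => complex.Im (u x - g x)) = (fun x => complex.Im (u x) - q.[cosv x]).
  by apply/funext => x; rewrite !ReImE.
lra.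
Qed.

Lemma diagonalized_by_e_N : diagonalized_by (A_N R) (lam_N R) (e_N R).
Proof. by split; [exact: hilbert_basis_e_N|exact: A_N_e_N]. Qed.

End NeumannBasis.


(** * Absolutely summable coefficients and uniform limits *)

Section UniformSummation.
Context {R : realType}.
Notation mu := (@lebesgue_measure R).
Notation I := (II R).

(** The sequence is Cauchy, and letting [m] tend to infinity in the hypothesis removes the term
    [d m] and keeps the rate [d n]. *)
Lemma dist_le_cvg (r d : nat -> R) : d n @[n --> \oo] --> (0 : R) ->
  (forall n m, `|r n - r m| <= d n + d m) ->
  exists2 l, r n @[n --> \oo] --> l & forall n, `|l - r n| <= d n.
Proof.
move=> d0 rd.
have dN (eps : R) : 0 < eps -> exists N, forall n, (N <= n)%N -> d n < eps.
  move=> e0; have /cvgrPdist_lt/(_ _ e0)[N _ HN] := d0.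
  exists N => n /HN; rewrite /= sub0r normrN; exact: le_lt_trans (ler_norm _).
have cr : cvg (r n @[n --> \oo]).
  apply/cauchy_cvgP/cauchy_exP => eps e0; have e2 : 0 < eps / 2 by lra.
  have [N HN] := dN _ e2; exists (r N); exists N => // n /= Nn.
  rewrite /ball/=; have := rd N n; have := HN _ (leqnn N); have := HN _ Nn; lra.
exists (limn r) => // n; apply/ler_addgt0Pr => eps e0.
have e2 : 0 < eps / 2 by lra.
have [N HN] := dN _ e2; have /cvgrPdist_lt/(_ _ e2)[M _ HM] := cr.
have := HM (maxn M N) (leq_maxl M N); have := HN _ (leq_maxr M N).
move=> /= h1 h2; have h3 := rd (maxn M N) n.
apply: (le_trans (ler_distD (r (maxn M N)) _ _)); lra.
Qed.

Section Family.
Variables (K : choiceType) (a : K -> R).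
Implicit Types J U : {fset K}.

Let S J := \sum_(k <- J) a k.

Lemma norm_sum_sub (F : K -> R) J U : (J `<=` U)%fset ->
  (forall k, `|F k| <= a k) ->
  `|\sum_(k <- U) F k - \sum_(k <- J) F k| <= S U - S J.
Proof.
move=> JU Fa.
have split (G : K -> R) : \sum_(k <- U) G k - \sum_(k <- J) G k =
    \sum_(k <- U | k \notin J) G k.
  rewrite (bigID (fun k => k \in J))/= addrAC.
  rewrite [X in X - _](_ : _ = \sum_(k <- J) G k) ?subrr ?add0r//.
  rewrite -big_filter; apply: perm_big; apply: uniq_perm.
  - by rewrite filter_uniq ?fset_uniq.
  - exact: fset_uniq.
  - by move=> k; rewrite mem_filter andb_idr// => /(fsubsetP JU).
rewrite /S !split; apply: le_trans (ler_norm_sum _ _ _) _.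
by apply: ler_sum => k _; exact: Fa.
Qed.

(** Choose [J_ n] with sum within [harmonic n] of the supremum of all finite sums; enlarging it
    cannot gain more than that gap. *)
Lemma summable_exhaustion (M : R) : (forall J, S J <= M) ->
  exists J_ : nat -> {fset K}, forall n U, S (J_ n `|` U)%fset - S (J_ n) <= harmonic n.
Proof.
move=> SM; pose E := [set S J | J in [set: {fset K}]].
have supE : has_sup E.
  by split; [exists (S fset0), fset0|exists M => _ [J _ <-]].
have ex n : exists J, sup E - harmonic n < S J.
  by have [_ [J _ <-]] := sup_adherent (harmonic_gt0 n) supE; exists J.
have [J_ HJ] := choice ex; exists J_ => n U.
have : S (J_ n `|` U)%fset <= sup E.
  by apply: sup_upper_bound => //; exists (J_ n `|` U)%fset.
have := HJ n; lra.
Qed.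

(** The exhaustion [J_] depends only on the majorant [a], so the same one serves for real and
    imaginary parts. In the rate, one [harmonic n] comes from the limit along [J_] and the other
    from enlarging [J_ n] to [J]. *)
Lemma real_uniform_sum (J_ : nat -> {fset K}) (F : K -> R -> R) :
  (forall n U, S (J_ n `|` U)%fset - S (J_ n) <= harmonic n) ->
  (forall k x, `|F k x| <= a k) -> (forall k, L2R (F k)) ->
  exists2 v : R -> R, L2R v & forall n J x, (J_ n `<=` J)%fset ->
    `|v x - \sum_(k <- J) F k x| <= 2 * harmonic n.
Proof.
move=> HJ Fa LF.
pose T n x := \sum_(k <- J_ n) F k x.
have TU n U x : `|\sum_(k <- (J_ n `|` U)%fset) F k x - T n x| <= harmonic n.
  apply: le_trans (HJ n U); apply: norm_sum_sub => //; exact: fsubsetUl.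
(* The sets [J_ n] need not be nested, so the two partial sums are compared through the union of
   their index sets. *)
have Td x n m : `|T n x - T m x| <= harmonic n + harmonic m.
  have h1 := TU n (J_ m) x; have h2 := TU m (J_ n) x.
  rewrite fsetUC in h2.
  rewrite distrC in h1.
  by apply: (le_trans (ler_distD (\sum_(k <- (J_ n `|` J_ m)%fset) F k x) _ _)); lra.
have ex x : exists l, T n x @[n --> \oo] --> l /\ forall n, `|l - T n x| <= harmonic n.
  by have [l] := dist_le_cvg (T ^~ x) harmonic cvg_harmonic (Td x); exists l.
have [v Hv] := choice ex.
have LT n : L2R (T n).
  rewrite /T; elim: (enum_fset _) => [|k J IH].
    by under eq_fun do rewrite big_nil; apply: continuous_L2R => x; exact: cvg_cst.
  by under eq_fun do rewrite big_cons; exact: L2RD.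
exists v; last first.
  move=> n J x JJ; have h1 := (Hv x).2 n; have h2 := TU n J x.
  move: h2; rewrite (fsetUidPr _ _ JJ) distrC => h2.
  by apply: (le_trans (ler_distD (T n x) _ _)); lra.
have mv : measurable_fun I v.
  apply: (@measurable_fun_cvg _ _ _ I T) => [n|x _]; first by case: (LT n).
  exact: (Hv x).1.
apply: (@bounded_L2R _ _ (harmonic 0 + S (J_ 0%N))) => // x _.
have := (Hv x).2 0%N; have : `|T 0%N x| <= S (J_ 0%N).
  by apply: le_trans (ler_norm_sum _ _ _) _; apply: ler_sum.
have := ler_distD 0 (v x) (T 0%N x); rewrite subr0 => _.
have -> : v x = (v x - T 0%N x) + T 0%N x by rewrite subrK.
move=> h1 h2; apply: le_trans (ler_normD _ _) _.
by rewrite subrK in h2 *; lra.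
Qed.

End Family.

Lemma normc_ge_abs_Re (z : R[i]) : `|complex.Re z| <= Normc.normc z.
Proof.
case: z => x y /=; rewrite -[leLHS]sqrtr_sqr; apply: ler_wsqrtr.
by rewrite lerDl sqr_ge0.
Qed.

Lemma normc_ge_abs_Im (z : R[i]) : `|complex.Im z| <= Normc.normc z.
Proof.
case: z => x y /=; rewrite -[leLHS]sqrtr_sqr; apply: ler_wsqrtr.
by rewrite lerDr sqr_ge0.
Qed.

Lemma normc_ge0 (z : R[i]) : 0 <= Normc.normc z.
Proof. by case: z => x y; exact: sqrtr_ge0. Qed.

Lemma has_L2_sum_exists (K : choiceType) (e : K -> R -> R[i]) (c : K -> R[i]) (M : R) :
  (forall k, L2C (e k)) -> (forall k x, Normc.normc (e k x) <= 1) ->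
  (forall J : {fset K}, \sum_(k <- J) Normc.normc (c k) <= M) ->
  exists v, has_L2_sum (fun k x => c k * e k x) v.
Proof.
move=> Le e1 cM; pose a k := Normc.normc (c k).
have [J_ HJ] := summable_exhaustion _ a M cM.
have ce1 k x : Normc.normc (c k * e k x) <= a k.
  by rewrite Normc.normcM -[leRHS]mulr1 ler_wpM2l ?normc_ge0.
have Lf k : L2C (fun x => c k * e k x) by exact: L2CZ.
have [v1 Lv1 Hv1] := real_uniform_sum _ a J_ (fun k x => complex.Re (c k * e k x)) HJ
  (fun k x => le_trans (normc_ge_abs_Re _) (ce1 k x)) (fun k => (Lf k).1).
have [v2 Lv2 Hv2] := real_uniform_sum _ a J_ (fun k x => complex.Im (c k * e k x)) HJ
  (fun k x => le_trans (normc_ge_abs_Im _) (ce1 k x)) (fun k => (Lf k).2).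
exists (fun x => v1 x +i* v2 x); split; first by split.
move=> eps e0; have e8 : 0 < eps / 8 by lra.
have [N HN] : exists N, harmonic N < eps / 8.
  have /cvgrPdist_lt/(_ _ e8)[N _ HN] := @cvg_harmonic R.
  exists N; have := HN N (leqnn N); rewrite /= sub0r normrN.
  exact: le_lt_trans (ler_norm _).
exists (J_ N) => J JJ; rewrite L2norm_ltE//.
set w := fun x => _; have Lw : L2C w.
  by apply: L2CB; [split|exact: L2C_sum].
pose h : R := 2 * harmonic N.
(* Each part of the error is at most [h] on [I], and the last factor [2] is the length of [I]. With
   [harmonic N < eps / 8] the total stays below [eps^2 / 4]. *)
apply: (@le_lt_trans _ _ ((h ^+ 2 + h ^+ 2) * 2)).
  apply: L2sq_le => // x _; rewrite /w /sqnorm !ReImE Re_sum Im_sum/=.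
  apply: lerD; rewrite -real_normK ?num_real// lerXn2r ?nnegrE ?mulr_ge0 ?harmonic_ge0//.
  - exact: Hv1.
  - exact: Hv2.
have : 0 <= harmonic N :> R by exact: harmonic_ge0.
rewrite /h; move: HN; move: (harmonic N) => d; rewrite !expr2; nra.
Qed.

End UniformSummation.

(** * Comparison of the convolutions with functions of [A_N] *)

Section Multipliers.
Context {R : realType}.
Notation mu := (@lebesgue_measure R).
Notation I := (II R).

Lemma ip_even_reflect (C : R -> R) (f : R -> R[i]) : L2R C -> ae_even C -> L2C f ->
  ip (fun x => f (- x)) (cplx C) = ip f (cplx C).
Proof.
move=> HC Ceven Hf; rewrite -[RHS]ip_reflect//; last exact: cplx_L2C.
apply: ae_ipr; [exact: L2C_reflect|exact: cplx_L2C|exact/L2C_reflect/cplx_L2C|].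
move: Ceven; apply: (@filterS _ _ (ae_filter_ringOfSetsType mu)) => x Cx Ix.
by rewrite /cplx Cx.
Qed.

Lemma ip_reflect_l (f u : R -> R[i]) : L2C f -> L2C u ->
  ip f (fun x => u (- x)) = ip (fun x => f (- x)) u.
Proof.
move=> Hf Hu; rewrite -(ip_reflect (fun x => f (- x)) u)//; last exact: L2C_reflect.
by congr ip; apply/funext => x; rewrite opprK.
Qed.

Lemma P_even_L2C (u : R -> R[i]) : L2C u -> L2C (P_even u).
Proof. by move=> Hu; apply: L2CZ; apply: L2CD => //; exact: L2C_reflect. Qed.

Lemma P_odd_L2C (u : R -> R[i]) : L2C u -> L2C (P_odd u).
Proof. by move=> Hu; apply: L2CZ; apply: L2CB => //; exact: L2C_reflect. Qed.

(** The reflection is symmetric for [ip], so it can be moved to [f]; applied to [f = e_k], this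
    averages the coefficients of [u] at [k] and at the reflected index. *)
Lemma ip_P_even (f u : R -> R[i]) : L2C f -> L2C u ->
  ip f (P_even u) = (2^-1)%:C * (ip f u + ip (fun x => f (- x)) u).
Proof.
move=> Hf Hu; have Hu' := L2C_reflect _ Hu.
by rewrite ipZr ?ipDr ?ip_reflect_l//; exact: L2CD.
Qed.

Lemma ip_P_odd (f u : R -> R[i]) : L2C f -> L2C u ->
  ip f (P_odd u) = (2^-1)%:C * (ip f u - ip (fun x => f (- x)) u).
Proof.
move=> Hf Hu; have Hu' := L2C_reflect _ Hu.
by rewrite ipZr ?ipBr ?ip_reflect_l//; exact: L2CB.
Qed.

Lemma normc_cis (t : R) : Normc.normc (((Num.sqrt 2)^-1)%:C * cis t) <= 1.
Proof.
rewrite -(@ler_pXn2r _ 2%N) ?nnegrE ?normc_ge0// -sqnorm_normc sqnormM expr1n.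
rewrite /sqnorm /cis /= cos2Dsin2 mulr1 expr0n addr0 exprVn sqr_sqrtr//.
by lra.
Qed.

Lemma sum_normc_mul_le (K : choiceType) (e : K -> R -> R[i]) (u w : R -> R[i])
    (J : {fset K}) :
  (forall k, L2C (e k)) -> (forall j k, ip (e j) (e k) = (j == k)%:R) ->
  L2C u -> L2C w ->
  \sum_(k <- J) Normc.normc (ip (e k) u * ip (e k) w) <= L2sq u + L2sq w.
Proof.
move=> He ee Hu Hw; have := bessel K e u J He ee Hu; have := bessel K e w J He ee Hw.
move=> hw hu; apply: le_trans (lerD hu hw); rewrite -big_split.
apply: ler_sum => k _; rewrite Normc.normcM !sqnorm_normc.
have := normc_ge0 (ip (e k) u); have := normc_ge0 (ip (e k) w).
move: (Normc.normc _) (Normc.normc _) => A B A0 B0; have := sqr_ge0 (A - B).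
by rewrite -[X in _ -> _ <= X]/(A ^+ 2 + B ^+ 2) !expr2; nra.
Qed.

(** The frame common to both identities: [p] sends the index of an exponential to that of its
    eigenfunction, and the last hypothesis compares the two series fiber by fiber. The sum [v0] over
    the exponentials exists by uniform summation, and regrouping makes it a sum of the eigenfunction
    series; either series then has exactly the sums of the other. *)
Lemma convolution_eq_calculus (e : int -> R -> R[i]) (C : R -> R[i])
    (Q : (R -> R[i]) -> R -> R[i]) (p : int -> nat) (s : nat -> {fset int})
    (phi : R -> R[i]) :
  (forall k, L2C (e k)) -> (forall j k, ip (e j) (e k) = (j == k)%:R) ->
  (forall k x, Normc.normc (e k x) <= 1) ->
  L2C C -> (forall u, L2C u -> L2C (Q u)) ->
  (forall k n, (k \in s n) = (p k == n)) ->
  (forall u n x, L2C u -> phi (lam_N R n) * ip (e_N R n) u * e_N R n x =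
     \sum_(k <- s n) ip (e k) C * ip (e k) (Q u) * e k x) ->
  eq_operator (fun u v => convolution e C (Q u) v)
    (functional_calculus (A_N R) (lam_N R) (e_N R) phi).
Proof.
move=> He ee e1 HC HQ sP sE u Hu.
have [v0 Hv0] := has_L2_sum_exists _ e (fun k => ip (e k) C * ip (e k) (Q u)) _ He e1
  (fun J => sum_normc_mul_le _ e C (Q u) J He ee HC (HQ _ Hu)).
have Hg := has_L2_sum_fibers _ _ p s _
  (fun n x => phi (lam_N R n) * ip (e_N R n) u * e_N R n x) _ sP
  (fun n x => sE u n x Hu) Hv0.
have Lf k : L2C (fun x => ip (e k) C * ip (e k) (Q u) * e k x) by exact: L2CZ.
have Lg n : L2C (fun x => phi (lam_N R n) * ip (e_N R n) u * e_N R n x).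
  by apply: L2CZ; exact: e_N_L2C.
split; first by exists v0.
move=> v; split=> [Hv|[_ Hv]].
  split; first exact: diagonalized_by_e_N.
  exact: (has_L2_sum_transfer _ _ _ _ v v0 Lf Lg Hv0 Hg Hv).
exact: (has_L2_sum_transfer _ _ _ _ v v0 Lg Lf Hg Hv0 Hv).
Qed.

(** Bessel's inequality for a single index bounds every [<e_k|C>] by the norm of [C]. *)
Lemma bounded_on_coef (K : choiceType) (e : K -> R -> R[i]) (C : R -> R[i])
    (phi : R -> R[i]) :
  (forall k, L2C (e k)) -> (forall j k, ip (e j) (e k) = (j == k)%:R) -> L2C C ->
  (forall n, phi (lam_N R n) = 0 \/ exists k, phi (lam_N R n) = ip (e k) C) ->
  bounded_on (spectrum_N R) phi.
Proof.
move=> He ee HC phiE; exists (Num.sqrt (L2sq C)) => _ [n _ <-].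
case: (phiE n) => [->|[k ->]]; first by rewrite normr0 lecR sqrtr_ge0.
rewrite normc_def lecR; apply: ler_wsqrtr.
have := bessel K e C [fset k]%fset He ee HC; rewrite big_seq_fset1.
exact.
Qed.

Lemma e_p_reflectE (k : int) : (fun x => e_p R k (- x)) = e_p R (- k).
Proof. by apply/funext => x; rewrite e_p_reflect. Qed.

Lemma e_a_reflectE (k : int) : (fun x => e_a R k (- x)) = e_a R (- k - 1).
Proof. by apply/funext => x; rewrite e_a_reflect. Qed.

(** The preimage of [n] under [k |-> |2 k|]; at [n = 0] the two listed elements coincide. *)
Definition fiber_p (n : nat) : {fset int} :=
  if odd n then fset0 else [fset (n./2)%:Z; - (n./2)%:Z]%fset.

Definition fiber_a (n : nat) : {fset int} :=
  if odd n then [fset (n./2)%:Z; - (n./2)%:Z - 1]%fset else fset0.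

Lemma mem_fiber_p (k : int) n : (k \in fiber_p n) = (absz (k * 2) == n).
Proof.
rewrite /fiber_p; have := odd_double_half n; case: (odd n) => /= nE.
  by rewrite in_fset0; apply/esym/eqP; lia.
by rewrite !inE; apply/idP/idP; lia.
Qed.

Lemma mem_fiber_a (k : int) n : (k \in fiber_a n) = (absz (k * 2 + 1) == n).
Proof.
rewrite /fiber_a; have := odd_double_half n; case: (odd n) => /= nE; last first.
  by rewrite in_fset0; apply/esym/eqP; lia.
by rewrite !inE; apply/idP/idP; lia.
Qed.

(** Evenness of [C] makes [<e_k|C>] constant on the fiber, and so is [<e_k|P_even u>]. What remains
    is half the product of [<e_j|u> + <e_-j|u>] and [e_j + e_-j]; by [e_p_even] the two sums carry
    the factors [w^*] and [w], and [|w|^2 = 2] cancels the half. *)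
Lemma convolution_p_fiber (C : R -> R) (phi u : R -> R[i]) (n : nat) (x : R) :
  L2R C -> ae_even C -> L2C u ->
  phi (lam_N R n) = (if odd n then 0 else ip (e_p R (Posz (n %/ 2)%N)) (cplx C)) ->
  phi (lam_N R n) * ip (e_N R n) u * e_N R n x =
  \sum_(k <- fiber_p n) ip (e_p R k) (cplx C) * ip (e_p R k) (P_even u) * e_p R k x.
Proof.
move=> HC Ce Hu ->; rewrite /fiber_p divn2; have := odd_double_half n.
case: (odd n) => /= [_|]; first by rewrite !mul0r big_seq_fset0.
move: (n./2) => j <-; rewrite add0n.
(* For [j = 0] the fiber is a single point and [e_p R 0] already equals [e_N R 0]. *)
have [->|j0] := posnP j.
  rewrite oppr0 fsetUid big_seq_fset1 ip_P_even//; last exact: e_p_L2C.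
  rewrite e_p_reflectE oppr0 e_p0; congr (_ * _ * _).
  by move: (ip _ _) => z; apply: complex_ext; rewrite !ReImE/=; field.
have AE : ip (e_p R (- j%:Z)) (cplx C) = ip (e_p R j) (cplx C).
  by rewrite -e_p_reflectE ip_even_reflect//; exact: e_p_L2C.
have jN : j%:Z \notin [fset - j%:Z]%fset by rewrite inE; lia.
rewrite big_fsetU1// big_seq_fset1 !ip_P_even; try by [|exact: e_p_L2C].
rewrite !e_p_reflectE opprK AE -[RHS]/(_ + _).
pose w : R[i] := (Num.sqrt 2 * (-1) ^+ j)%:C.
have ww : w^*%C * w = 2%:C.
  rewrite mulJc_sqnorm /sqnorm /w /= expr0n addr0 exprMn sqr_sqrtr//.
  by rewrite -exprM mulnC exprM sqrrN expr1n expr1n mulr1.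
have wE y : e_p R j y + e_p R (- j%:Z) y = w * e_N R j.*2 y.
  by rewrite e_p_even// muln2.
have UE : ip (e_p R j) u + ip (e_p R (- j%:Z)) u = w^*%C * ip (e_N R j.*2) u.
  rewrite -ipDl//; try exact: e_p_L2C.
  rewrite -ipZl//; last exact: e_N_L2C.
  by congr ip; apply/funext => y; rewrite wE.
rewrite [ip (e_p R (- _)) u + _]addrC UE -mulrDr wE.
move: (ip _ (cplx C)) (ip _ u) (e_N R _ x) => A N E.
transitivity ((2^-1)%:C * (w^*%C * w) * (A * N * E)); last by ring.
by rewrite ww -rmorphM/= mulVf// mul1r.
Qed.

(** As in the periodic case, except that the coefficients of [P_odd u] at [j] and [-j-1] are
    opposite, so differences replace sums. The two indices are always distinct, so no degenerate
    fiber occurs. *)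
Lemma convolution_a_fiber (C : R -> R) (phi u : R -> R[i]) (n : nat) (x : R) :
  L2R C -> ae_even C -> L2C u ->
  phi (lam_N R n) = (if odd n then ip (e_a R (Posz ((n - 1) %/ 2)%N)) (cplx C) else 0) ->
  phi (lam_N R n) * ip (e_N R n) u * e_N R n x =
  \sum_(k <- fiber_a n) ip (e_a R k) (cplx C) * ip (e_a R k) (P_odd u) * e_a R k x.
Proof.
move=> HC Ce Hu ->; rewrite /fiber_a; have := odd_double_half n.
case: (odd n) => /= [|_]; last by rewrite !mul0r big_seq_fset0.
move: (n./2) => j <-; rewrite add1n subSS subn0 divn2 doubleK.
have AE : ip (e_a R (- j%:Z - 1)) (cplx C) = ip (e_a R j) (cplx C).
  by rewrite -e_a_reflectE ip_even_reflect//; exact: e_a_L2C.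
have jN : j%:Z \notin [fset - j%:Z - 1]%fset by rewrite inE; lia.
rewrite big_fsetU1// big_seq_fset1 !ip_P_odd; try by [|exact: e_a_L2C].
have jj : - (- j%:Z - 1) - 1 = j%:Z by lia.
rewrite !e_a_reflectE jj AE -[RHS]/(_ + _).
pose w : R[i] := 0 -i* (Num.sqrt 2 * (-1) ^+ j).
have ww : w^*%C * w = 2%:C.
  rewrite mulJc_sqnorm /sqnorm /w /= expr0n add0r sqrrN exprMn sqr_sqrtr//.
  by rewrite -exprM mulnC exprM sqrrN expr1n expr1n mulr1.
have wE y : e_a R j y - e_a R (- j%:Z - 1) y = w * e_N R j.*2.+1 y.
  by rewrite e_a_odd// muln2.
have UE : ip (e_a R j) u - ip (e_a R (- j%:Z - 1)) u = w^*%C * ip (e_N R j.*2.+1) u.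
  rewrite -ipBl//; try exact: e_a_L2C.
  rewrite -ipZl//; last exact: e_N_L2C.
  by congr ip; apply/funext => y; rewrite wE.
move: UE (wE x).
move: (ip _ (cplx C)) (ip (e_N _ _) u) (e_N R _ x) => A N E.
move: (ip (e_a R j) u) (ip (e_a R (- _ - _)) u) => U V.
move: (e_a R j x) (e_a R (- _ - _) x) => X Y UE XE.
transitivity (A * ((2^-1)%:C * (U - V)) * (X - Y)); last by ring.
rewrite UE XE.
transitivity ((2^-1)%:C * (w^*%C * w) * (A * N * E)); last by ring.
by rewrite ww -rmorphM/= mulVf// mul1r.
Qed.

End Multipliers.

Theorem mainTheorem15 (R : realType) (C : R -> R)
    (C_L2 : L2R C) (C_even : ae_even C)
    (phi1 phi2 : R -> R[i])
    (phi1E : forall k : nat, phi1 (lam_N R k) =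
       if odd k then 0 else ip (e_p R (Posz (k %/ 2)%N)) (cplx C))
    (phi2E : forall k : nat, phi2 (lam_N R k) =
       if odd k then ip (e_a R (Posz ((k - 1) %/ 2)%N)) (cplx C) else 0) :
  [/\ bounded_on (spectrum_N R) phi1,
      bounded_on (spectrum_N R) phi2,
      eq_operator (fun u v => convolution (e_p R) (cplx C) (P_even u) v)
                  (functional_calculus (A_N R) (lam_N R) (e_N R) phi1) &
      eq_operator (fun u v => convolution (e_a R) (cplx C) (P_odd u) v)
                  (functional_calculus (A_N R) (lam_N R) (e_N R) phi2)].
Proof.
have LC := cplx_L2C _ C_L2; split.
- apply: (bounded_on_coef _ (e_p R) (cplx C) phi1 e_p_L2C ip_e_p LC) => n.
  by rewrite phi1E; case: (odd n); [left|right; eexists].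
- apply: (bounded_on_coef _ (e_a R) (cplx C) phi2 e_a_L2C ip_e_a LC) => n.
  by rewrite phi2E; case: (odd n); [right; eexists|left].
(* The frequency [pi k] of [e_p] is, up to sign, the frequency [n pi / 2] of [e_N] with [n = |2 k|];
   for [e_a] the shift by [1/2] gives [n = |2 k + 1|]. *)
- apply: (convolution_eq_calculus (e_p R) (cplx C) (@P_even R)
    (fun k => absz (k * 2)) fiber_p).
  + exact: e_p_L2C.
  + exact: ip_e_p.
  + by move=> k x; exact: normc_cis.
  + exact: LC.
  + exact: P_even_L2C.
  + exact: mem_fiber_p.
  + by move=> u n x Hu; apply: convolution_p_fiber.
- apply: (convolution_eq_calculus (e_a R) (cplx C) (@P_odd R)
    (fun k => absz (k * 2 + 1)) fiber_a).
  + exact: e_a_L2C.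
  + exact: ip_e_a.
  + by move=> k x; exact: normc_cis.
  + exact: LC.
  + exact: P_odd_L2C.
  + exact: mem_fiber_a.
  + by move=> u n x Hu; apply: convolution_a_fiber.
Qed.
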